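(* Let $N\ge0$, $a(0),\dots,a(N)\in\mathbb C$, $P_0>0$, and $$D_0=\left\{f(\lambda):\frac1{2\pi}\int_{-\pi}^\pi f(\lambda)d\lambda\le P_0\right\}.$$ For $d=(d(0),\dots,d(N))\in\mathbb C^{N+1}$ put, for $k=0,\dots,N$, $$(A_Nd)_k=\sum_{l=0}^{N-k}a(k+l)d(l),\qquad(\tilde A_Nd)_k=\sum_{u=0}^{k}a(N-k+u)d(u).$$ Consider all $d$ with $\|d\|^2=\sum_{k=0}^N|d(k)|^2=P_0$ that solve $A_Nd=\alpha\overline d$ for some $\alpha\in\mathbb C$ or $\tilde A_Nd=\beta d$ for some $\beta\in\mathbb C$, and let $d^0=\{d^0(k):k=0,\dots,N\}$ be one of them giving the maximum value $\|A_Nd^0\|^2=\|\tilde A_Nd^0\|^2=\nu_N^2P_0$ of the quantity $\|A_Nd\|^2$. Then the spectral density $$f^0(\lambda)=\left|\sum_{k=0}^Nd^0(k)e^{-ik\lambda}\right|^2$$ of the one-sided moving average sequence of order $N$, $\xi(j)=\sum_{u=j-N}^jd^0(j-u)\varepsilon(u)$, is least favourable in $D_0$ for the optimal extrapolation of $A_N\xi=\sum_{j=0}^Na(j)\xi(j)$ from observations of $\xi(j)$, $j=-1,-2,\dots$. The minimax spectral characteristic of the optimal estimate of $A_N\xi$ is $$h^0=\sum_{j=0}^Na(j)e^{ij\lambda}-\left(\sum_{k=0}^Nd^0(k)e^{-ik\lambda}\right)^{-1}\sum_{k=0}^N(A_Nd^0)_ke^{ik\lambda}.$$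
   Context: $\overline d$ is the coordinatewise complex conjugate; $\varepsilon$ is white noise, $E\varepsilon(i)\overline{\varepsilon(j)}=\delta_{ij}$. $\xi$ is a zero mean wide sense stationary sequence with spectral density $f$: $E\xi(j+k)\overline{\xi(j)}=\frac1{2\pi}\int_{-\pi}^\pi e^{ik\lambda}f(\lambda)d\lambda$. $L_2^-(f)$ is the closed subspace of $L_2(f)$ generated by $e^{in\lambda}$, $n\le-1$; $\Delta(h,f)=\frac1{2\pi}\int_{-\pi}^\pi|A_N(e^{i\lambda})-h(e^{i\lambda})|^2f(\lambda)d\lambda$, $A_N(e^{i\lambda})=\sum_{j=0}^Na(j)e^{ij\lambda}$; $h(f)$ minimizes $\Delta(\cdot,f)$ over $L_2^-(f)$. For a class $D$ of densities, $f^0\in D$ is least favourable if $\Delta(h(f^0),f^0)=\max_{f\in D}\min_{h\in L_2^-(f)}\Delta(h,f)$. A spectral characteristic $h^0$ is minimax (robust) if $h^0\in H_D=\bigcap_{f\in D}L_2^-(f)$ and $\min_{h\in H_D}\max_{f\in D}\Delta(h,f)=\max_{f\in D}\Delta(h^0,f)$. *)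

(* Defs.v *)
(* MathComp-Analysis, with complex numbers R[i] from mathcomp-real-closed. *)
From HB Require Import structures.
From mathcomp Require Import all_boot all_order all_algebra.
From mathcomp Require Import complex.
From mathcomp Require Import all_classical all_reals all_analysis.
Set Implicit Arguments.
Unset Strict Implicit.
Unset Printing Implicit Defensive.
Import Order.TTheory GRing.Theory Num.Theory numFieldNormedType.Exports.
Local Open Scope classical_set_scope.
Local Open Scope complex_scope.
Local Open Scope ring_scope.

(* The modulus as an element of R; the norm of R[i] takes its values in R[i]. *)
Notation cabs := ComplexField.Normc.normc.

Definition cmeasurable (R : realType) d (T : measurableType d) (D : set T)
    (h : T -> R[i]) : Prop :=
  measurable_fun D (fun x => complex.Re (h x)) /\
  measurable_fun D (fun x => complex.Im (h x)).

(* A junk value when the real or the imaginary part is not integrable; it is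
   only used below on integrable functions. *)
Definition cintegral (R : realType) d (T : measurableType d)
    (mu : {measure set T -> \bar R}) (D : set T) (h : T -> R[i]) : R[i] :=
  (\int[mu]_(x in D) complex.Re (h x)) +i* (\int[mu]_(x in D) complex.Im (h x)).

Definition expi (R : realType) (t : R) : R[i] := cos t +i* sin t.

Definition circle (R : realType) : set R := `[- pi, pi]%classic.

(* (2 pi)^-1 \int_(-pi)^pi g, for g >= 0 *)
Definition circle_mean (R : realType) (g : R -> R) : \bar R :=
  (((2 * pi)^-1)%:E *
   \int[@lebesgue_measure R]_(x in @circle R) (g x)%:E)%E.

Definition circle_cmean (R : realType) (g : R -> R[i]) : R[i] :=
  ((2 * pi)^-1)%:C * cintegral (@lebesgue_measure R) (@circle R) g.

Definition spectral_density (R : realType) (f : R -> R) : Prop :=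
  [/\ measurable_fun (@circle R) f,
      (forall x, @circle R x -> 0 <= f x)
    & (circle_mean f < +oo)%E].

Definition D0 (R : realType) (P0 : R) : set (R -> R) :=
  [set f | spectral_density f /\ (circle_mean f <= P0%:E)%E].

(* Elements of L_2(f) are represented by functions on [-pi, pi]. *)
Definition sqnorm_L2 (R : realType) (f : R -> R) (h : R -> R[i]) : \bar R :=
  circle_mean (fun x => cabs (h x) ^+ 2 * f x).

Definition L2 (R : realType) (f : R -> R) : set (R -> R[i]) :=
  [set h | cmeasurable (@circle R) h /\ (sqnorm_L2 f h < +oo)%E].

Definition past_poly (R : realType) (n : nat) (c : nat -> R[i]) (x : R) : R[i] :=
  \sum_(k < n) c k * expi (- (k.+1%:R * x)).

Definition L2minus (R : realType) (f : R -> R) : set (R -> R[i]) :=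
  [set h | L2 f h /\
     forall e : R, 0 < e -> exists n c,
       (sqnorm_L2 f (fun x => h x - past_poly n c x)%R < e%:E)%E].

Definition H_class (R : realType) (D : set (R -> R)) : set (R -> R[i]) :=
  \bigcap_(f in D) L2minus f.

Definition A_fun (R : realType) (N : nat) (a : 'cV[R[i]]_N.+1) (x : R) : R[i] :=
  \sum_(j < N.+1) a j 0 * expi (j%:R * x).

Definition Delta (R : realType) (N : nat) (a : 'cV[R[i]]_N.+1)
    (h : R -> R[i]) (f : R -> R) : \bar R :=
  sqnorm_L2 f (fun x => A_fun a x - h x).

(* [h] is (a version of) the minimizer h(f). *)
Definition optimal_char (R : realType) (N : nat) (a : 'cV[R[i]]_N.+1)
    (f : R -> R) (h : R -> R[i]) : Prop :=
  L2minus f h /\ forall g, L2minus f g -> (Delta a h f <= Delta a g f)%E.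

(* The infimum is a minimum, by orthogonal projection in L_2(f). *)
Definition min_error (R : realType) (N : nat) (a : 'cV[R[i]]_N.+1)
    (f : R -> R) : \bar R :=
  ereal_inf [set Delta a h f | h in L2minus f].

(* May be infinite, or not attained, for an arbitrary [h]. *)
Definition max_error (R : realType) (N : nat) (a : 'cV[R[i]]_N.+1)
    (D : set (R -> R)) (h : R -> R[i]) : \bar R :=
  ereal_sup [set Delta a h f | f in D].

(* As [f0] is in [D], the supremum is attained at [f0]. *)
Definition least_favourable (R : realType) (N : nat) (a : 'cV[R[i]]_N.+1)
    (D : set (R -> R)) (f0 : R -> R) : Prop :=
  D f0 /\
  exists2 h, optimal_char a f0 h &
    Delta a h f0 = ereal_sup [set min_error a f | f in D].

(* The second clause says that the maximum over [D] of the error of [h0] is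
   attained; as [h0] is in [H_class D], the infimum in the third one is
   attained at [h0]. *)
Definition minimax_char (R : realType) (N : nat) (a : 'cV[R[i]]_N.+1)
    (D : set (R -> R)) (h0 : R -> R[i]) : Prop :=
  [/\ H_class D h0,
      (exists2 f, D f & Delta a h0 f = max_error a D h0)
    & ereal_inf [set max_error a D h | h in H_class D] = max_error a D h0].

Definition opA (R : realType) (N : nat) (a d : 'cV[R[i]]_N.+1) :
    'cV[R[i]]_N.+1 :=
  \col_k \sum_(l < N.+1 | (k + l <= N)%N) a (inord (k + l)) 0 * d l 0.

Definition opAt (R : realType) (N : nat) (a d : 'cV[R[i]]_N.+1) :
    'cV[R[i]]_N.+1 :=
  \col_k \sum_(u < N.+1 | (u <= k)%N) a (inord (N - k + u)) 0 * d u 0.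

Definition sqnorm (R : realType) (n : nat) (d : 'cV[R[i]]_n) : R :=
  \sum_(k < n) cabs (d k 0) ^+ 2.

Definition candidate (R : realType) (N : nat) (a : 'cV[R[i]]_N.+1) (P0 : R) :
    set 'cV[R[i]]_N.+1 :=
  [set d | sqnorm d = P0 /\
     ((exists alpha : R[i], opA a d = alpha *: map_mx (@conjc R) d) \/
      (exists beta : R[i], opAt a d = beta *: d))].

Definition ma_poly (R : realType) (N : nat) (d : 'cV[R[i]]_N.+1) (x : R) :
    R[i] :=
  \sum_(k < N.+1) d k 0 * expi (- (k%:R * x)).

Definition ma_density (R : realType) (N : nat) (d : 'cV[R[i]]_N.+1) (x : R) :
    R :=
  cabs (ma_poly d x) ^+ 2.

(* The inverse is 0 at the zeros of [ma_poly d], finitely many in [-pi, pi] when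
   [d != 0]. *)
Definition h_char (R : realType) (N : nat) (a d : 'cV[R[i]]_N.+1) (x : R) :
    R[i] :=
  A_fun a x -
  (ma_poly d x)^-1 * \sum_(k < N.+1) opA a d k 0 * expi (k%:R * x).

Definition second_order (R : realType) d (T : measurableType d)
    (P : probability T R) (X : T -> R[i]) : Prop :=
  cmeasurable setT X /\ (\int[P]_w (cabs (X w) ^+ 2)%:E < +oo)%E.

Definition cexpectation (R : realType) d (T : measurableType d)
    (P : probability T R) (X : T -> R[i]) : R[i] :=
  cintegral P setT X.

(* White noise is centred and normalized. *)
Definition white_noise (R : realType) d (T : measurableType d)
    (P : probability T R) (eps : int -> T -> R[i]) : Prop :=
  [/\ forall i, second_order P (eps i),
      forall i, cexpectation P (eps i) = 0
    & forall i j, cexpectation P (fun w => eps i w * conjc (eps j w)) =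
                  (i == j)%:R].

(* Wide sense stationarity is part of the last clause, whose right-hand side
   does not depend on [j]. *)
Definition has_spectral_density (R : realType) d (T : measurableType d)
    (P : probability T R) (xi : int -> T -> R[i]) (f : R -> R) : Prop :=
  [/\ spectral_density f,
      forall j, second_order P (xi j),
      forall j, cexpectation P (xi j) = 0
    & forall j k : int,
        cexpectation P (fun w => xi (j + k) w * conjc (xi j w)) =
        circle_cmean (fun x => expi (k%:~R * x) * (f x)%:C)].

(* \sum_(u = j - N)^j d(j - u) eps(u), with m = j - u *)
Definition moving_average (R : realType) (T : Type) (N : nat)
    (d : 'cV[R[i]]_N.+1) (eps : int -> T -> R[i]) (j : int) (w : T) : R[i] :=
  \sum_(m < N.+1) d m 0 * eps (j - m%:Z) w.

(* Main.v *)
(* In the variable z = exp (- i x), [ma_poly d] is a polynomial d(z) of degree at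
   most N, A_N is z^(-N) c(z) with c the reversal of the polynomial of a, and
   \tilde A_N is multiplication by c modulo z^(N+1).  A top eigenvector v of
   A_N^* A_N yields a con-eigenvector conj (A_N v) + nu v, so the candidates see
   the whole operator norm, and nu_N^2 is its square.

   Let d be a maximal vector and b = \tilde A_N d.  First variation of the norm in
   the directions (sum_m z^(-m) X^m) d gives |b|^2 = nu^2 |d|^2 at every point of
   the unit circle.  Reflecting an inner root of d in the circle keeps the norm of
   d and can only increase the norm of its image; by maximality nothing changes,
   and that root is shared by b.  So b/d = b'/d' with d' free of roots in the
   closed disc and c d' - b' divisible by z^(N+1).  Hence, outside the finitely
   many zeros of d, h^0 = z^(-N) (c - b/d) is z times a function analytic on the
   closed disc, a uniform limit of polynomials in z: it belongs to L_2^-(f) for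
   every f, and its error is nu^2 times the mean of f, at most nu^2 P_0.

   Conversely, the error of a polynomial of the past at f^0 is, by Parseval, the
   squared norm of a polynomial that agrees with c d modulo z^(N+1), hence at least
   |b|^2 = nu^2 P_0.  Thus (h^0, f^0) is a saddle point. *)
Require Import Defs.
From HB Require Import structures.
From mathcomp Require Import all_boot all_order all_algebra.
From mathcomp Require Import complex.
From mathcomp Require Import all_classical all_reals all_analysis.
From mathcomp Require Import measurable_realfun.
From mathcomp Require Import ring lra.
Set Implicit Arguments.
Unset Strict Implicit.
Unset Printing Implicit Defensive.
Import Order.TTheory GRing.Theory Num.Theory numFieldNormedType.Exports.
Local Open Scope classical_set_scope.
Local Open Scope complex_scope.
Local Open Scope ring_scope.

(** * The modulus on R[i], and the real inner product of the plane *)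

Section ComplexModulus.
Context {R : rcfType}.
Implicit Types (u v w z : R[i]).

Lemma cabs2E z : cabs z ^+ 2 = complex.Re z ^+ 2 + complex.Im z ^+ 2.
Proof. by case: z => x y /=; rewrite sqr_sqrtr // addr_ge0 ?sqr_ge0. Qed.

Lemma cabs_ge0 z : 0 <= cabs z.
Proof. by case: z => x y /=; exact: sqrtr_ge0. Qed.

Lemma cabs_gt0 z : (0 < cabs z) = (z != 0).
Proof.
rewrite lt_neqAle cabs_ge0 andbT eq_sym; congr negb.
apply/eqP/eqP => [/ComplexField.Normc.eq0_normc//|->].
exact: ComplexField.Normc.normc0.
Qed.

Lemma cabs0 : cabs (0 : R[i]) = 0.
Proof. exact: ComplexField.Normc.normc0. Qed.

Lemma cabsJ z : cabs z^* = cabs z.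
Proof. by case: z => x y /=; rewrite sqrrN. Qed.

Lemma cabsX z n : cabs (z ^+ n) = cabs z ^+ n.
Proof.
elim: n => [|n IH]; first exact: ComplexField.Normc.normc1.
by rewrite !exprS ComplexField.Normc.normcM IH.
Qed.

Lemma cabs_real (x : R) : cabs x%:C = `|x|.
Proof. by rewrite /= expr0n addr0 sqrtr_sqr. Qed.

Lemma cabs_le_sqr (p : R) z : 0 <= p -> (cabs z <= p) = (cabs z ^+ 2 <= p ^+ 2).
Proof. by move=> p0; rewrite ler_pXn2r // nnegrE cabs_ge0. Qed.

Lemma mulJc z : z * z^* = (cabs z ^+ 2)%:C.
Proof. by rewrite cabs2E; case: z => x y; simpc; congr (_ +i* _); ring. Qed.

Lemma ReD u v : complex.Re (u + v) = complex.Re u + complex.Re v.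
Proof. by case: u; case: v. Qed.

Lemma ImD u v : complex.Im (u + v) = complex.Im u + complex.Im v.
Proof. by case: u; case: v. Qed.

Lemma Re_sum I (r : seq I) (P : pred I) (F : I -> R[i]) :
  complex.Re (\sum_(i <- r | P i) F i) = \sum_(i <- r | P i) complex.Re (F i).
Proof. exact: (big_morph _ ReD). Qed.

(** The Euclidean inner product of the plane, i.e. the real part of conj(u) v; it is the polar form
    of the squared modulus. *)
Definition redot u v : R :=
  complex.Re u * complex.Re v + complex.Im u * complex.Im v.

Lemma redotM w u v : redot (w * u) (w * v) = cabs w ^+ 2 * redot u v.
Proof.
by rewrite cabs2E; case: w => a b; case: u => x y; case: v => s t;
  rewrite /redot /=; ring.
Qed.

Lemma redot_polar u v :
  2 * redot u v = cabs v ^+ 2 - cabs (v - u) ^+ 2 + cabs u ^+ 2.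
Proof. by rewrite !cabs2E; case: u => x y; case: v => s t; rewrite /redot /=; ring. Qed.

Lemma cabs2_line u v (t : R) :
  cabs (u + t%:C * v) ^+ 2 = cabs u ^+ 2 + t * 2 * redot u v + t ^+ 2 * cabs v ^+ 2.
Proof. by rewrite !cabs2E; case: u => x y; case: v => a b; rewrite /redot /=; ring. Qed.

(** Young's inequality: the right-hand side exceeds (|u| + |v|)^2 by a square divided by t. The free
    weight t lets an L_2 approximation error be absorbed without a triangle inequality for the
    norm. *)
Lemma cabs2D_le (t : R) u v : 0 < t ->
  cabs (u + v) ^+ 2 <= (1 + t) * cabs u ^+ 2 + (1 + t^-1) * cabs v ^+ 2.
Proof.
move=> t0; have := sqr_ge0 (t * cabs u - cabs v).
have : cabs (u + v) ^+ 2 <= (cabs u + cabs v) ^+ 2.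
  by rewrite lerXn2r ?nnegrE ?addr_ge0 ?cabs_ge0 // le_normcD.
move=> le1 sq; apply: le_trans le1 _; rewrite -subr_ge0.
have -> : (1 + t) * cabs u ^+ 2 + (1 + t^-1) * cabs v ^+ 2 - (cabs u + cabs v) ^+ 2 =
    t^-1 * (t * cabs u - cabs v) ^+ 2 by field; rewrite gt_eqF.
by rewrite mulr_ge0 // invr_ge0 ltW.
Qed.

End ComplexModulus.

(** The first-order condition at a minimum, free of calculus. *)
Lemma linear_term_eq0 (R : realFieldType) (b c : R) :
  (forall t, 0 <= t * b + t ^+ 2 * c) -> b = 0.
Proof.
move=> H; apply/eqP; apply: contraT => b0.
have k0 : 0 < 1 + `|c| by rewrite ltr_pwDl.
(* This t makes the quadratic a square times c - (1 + |c|), which is negative unless b = 0; the 1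
   keeps the denominator positive. *)
have := H (- b / (1 + `|c|)).
have -> : - b / (1 + `|c|) * b + (- b / (1 + `|c|)) ^+ 2 * c =
  (b / (1 + `|c|)) ^+ 2 * (c - (1 + `|c|)) by field; rewrite gt_eqF.
have s0 : 0 < (b / (1 + `|c|)) ^+ 2.
  by rewrite exprn_even_gt0 //= mulf_neq0 // invr_eq0 gt_eqF.
by rewrite pmulr_rge0 //; have := ler_norm c; lra.
Qed.

(** * First variation of multiplication modulo a power of X *)

Section TruncatedMultiplication.
Context {R : rcfType}.
Implicit Types (c d p q : {poly R[i]}).

Definition pnorm n p : R := \sum_(k < n) cabs p`_k ^+ 2.

Definition pdot n p q : R := \sum_(k < n) redot p`_k q`_k.

Lemma pnorm_ge0 n p : 0 <= pnorm n p.
Proof. by apply: sumr_ge0 => k _; exact: sqr_ge0. Qed.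

Lemma pnorm_line n p q (t : R) :
  pnorm n (p + t%:C *: q) = pnorm n p + t * 2 * pdot n p q + t ^+ 2 * pnorm n q.
Proof.
rewrite /pnorm /pdot !mulr_sumr -!big_split /=.
by apply: eq_bigr => k _; rewrite coefD coefZ cabs2_line.
Qed.

(* [pnorm n] sees only the coefficients below [n], so this is about multiplication
   by [c] modulo ['X^n]. *)
Definition maximal n (mu : R) c d :=
  (forall q, pnorm n (c * q) <= mu * pnorm n q) /\
  pnorm n (c * d) = mu * pnorm n d.

(** The quadratic form mu |q|^2 - |c q|^2 is nonnegative and vanishes at d, so d minimizes it and
    its polar form at d is zero in every direction. *)
Lemma maximal_pdot n mu c d q : maximal n mu c d ->
  pdot n (c * d) (c * q) = mu * pdot n d q.
Proof.
move=> [bnd att]; apply/eqP; rewrite eq_sym -subr_eq0; apply/eqP.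
have two0 : (2 : R) != 0 by rewrite pnatr_eq0.
apply: (mulfI two0); rewrite mulr0.
apply: (@linear_term_eq0 _ _ (mu * pnorm n q - pnorm n (c * q))) => t.
have := bnd (d + t%:C *: q).
rewrite mulrDr -scalerAr !pnorm_line att !mulrDr -subr_ge0.
by congr (0 <= _); ring.
Qed.

(* With S_k the partial sums of p at z, the k-th term of the left-hand side is
   2 Re (conj (S_(k+1) - S_k) S_(k+1)), and the sum telescopes. *)
Lemma pdot_geometric n p (z : R[i]) : cabs z = 1 ->
  2 * pdot n p ((\poly_(m < n) z^-1 ^+ m) * p) =
  cabs (take_poly n p).[z] ^+ 2 + pnorm n p.
Proof.
move=> z1; have z0 : z != 0 by rewrite -cabs_gt0 z1.
pose S k := \sum_(j < k) p`_j * z ^+ j.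
have shift k : (k < n)%N ->
    z ^+ k * ((\poly_(m < n) z^-1 ^+ m) * p)`_k = S k.+1.
  move=> kn; rewrite coefMr mulr_sumr /S; apply: eq_bigr => j _.
  have jk : (j <= k)%N by rewrite -ltnS.
  rewrite coef_poly (leq_ltn_trans (leq_subr _ _) kn).
  rewrite -[in z ^+ k](subnK jk) exprD exprVn mulrACA mulfV ?expf_neq0 //.
  by rewrite mul1r mulrC.
have -> : (take_poly n p).[z] = S n.
  by rewrite /take_poly horner_poly.
have -> : cabs (S n) ^+ 2 = \sum_(k < n) (cabs (S k.+1) ^+ 2 - cabs (S k) ^+ 2).
  rewrite -(big_mkord xpredT (fun k => cabs (S k.+1) ^+ 2 - cabs (S k) ^+ 2)) //.
  by rewrite telescope_sumr // /S big_ord0 cabs0 expr0n subr0.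
rewrite /pnorm -big_split /pdot mulr_sumr; apply: eq_bigr => k _ /=.
have zk : cabs (z ^+ k) ^+ 2 = 1 by rewrite cabsX z1 !expr1n.
rewrite -[redot _ _]mul1r -[X in X * redot _ _]zk -redotM shift // redot_polar.
rewrite [in X in _ - X]/S big_ord_recr /= [_ * z ^+ k]mulrC addrK.
by rewrite ComplexField.Normc.normcM exprMn zk mul1r.
Qed.

(** The variation is taken in the direction of the geometric polynomial times d. Multiplication by c
    commutes with it, so [pdot_geometric] applies to c d and to d alike, and the two norm terms
    cancel. *)
Lemma maximal_cabs n mu c d (z : R[i]) : maximal n mu c d -> cabs z = 1 ->
  cabs (take_poly n (c * d)).[z] ^+ 2 = mu * cabs (take_poly n d).[z] ^+ 2.
Proof.
move=> md z1; have := @maximal_pdot _ _ _ _ ((\poly_(m < n) z^-1 ^+ m) * d) md.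
rewrite mulrCA => e; have := pdot_geometric n (c * d) z1.
have := pdot_geometric n d z1; have [_ ->] := md.
move=> eq_d; rewrite e mulrCA eq_d mulrDr => /addIr ->.
by [].
Qed.

End TruncatedMultiplication.

(** * Reflecting the inner roots in the unit circle *)

Section ReflectedRoots.
Context {R : rcfType}.
Implicit Types (mu : R) (b c d e g p q s : {poly R[i]}) (w z : R[i]).

(** The two linear factors have equal modulus on the circle, so the untruncated products have equal
    norms when e has degree at most n. Truncation discards the coefficients of degree n + 1, of
    moduli |w| |e_n| and |e_n|, whence the correction. *)
Lemma pnorm_reflect n w e :
  pnorm n.+1 ((1 - w^* *: 'X) * e) =
  pnorm n.+1 (('X - w%:P) * e) + (1 - cabs w ^+ 2) * cabs e`_n ^+ 2.
Proof.
have E0 : ((1 - w^* *: 'X) * e)`_0 = e`_0.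
  by rewrite mulrBl mul1r -scalerAl coefB coefZ coefXM mulr0 subr0.
have E1 k : ((1 - w^* *: 'X) * e)`_k.+1 = e`_k.+1 - w^* * e`_k.
  by rewrite mulrBl mul1r -scalerAl coefB coefZ coefXM.
have F0 : (('X - w%:P) * e)`_0 = - (w * e`_0).
  by rewrite mulrBl coefB coefXM coefCM sub0r.
have F1 k : (('X - w%:P) * e)`_k.+1 = e`_k - w * e`_k.+1.
  by rewrite mulrBl coefB coefXM coefCM.
rewrite /pnorm; elim: n => [|n IH].
  rewrite !big_ord1 E0 F0 normcN ComplexField.Normc.normcM exprMn.
  by ring.
rewrite big_ord_recr [in RHS]big_ord_recr /= IH E1 F1 !cabs2E.
case: w {E0 E1 F0 F1 IH} (e`_n.+1) (e`_n) => [x y] [u v] [k l]; rewrite /=; ring.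
Qed.

(** Reflection keeps the norm of the vector, since e_n = 0, and adds (1 - |w|^2) |(c e)_n|^2 to the
    norm of its image. Maximality forbids any gain. *)
Lemma maximal_reflect n mu c w e : cabs w < 1 -> (size e <= n)%N ->
  maximal n.+1 mu c (('X - w%:P) * e) ->
  maximal n.+1 mu c ((1 - w^* *: 'X) * e) /\ (c * e)`_n = 0.
Proof.
move=> w1 se [bnd att].
have eqd : pnorm n.+1 ((1 - w^* *: 'X) * e) = pnorm n.+1 (('X - w%:P) * e).
  by rewrite pnorm_reflect [e`_n]nth_default // cabs0 expr0n mulr0 addr0.
have w2 : 0 < 1 - cabs w ^+ 2 by rewrite subr_gt0 expr_lt1 // cabs_ge0.
have /= := bnd ((1 - w^* *: 'X) * e).
rewrite eqd -att !(mulrCA c) pnorm_reflect gerDl pmulr_rle0 // => le0.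
have ce0 : (c * e)`_n = 0.
  apply/eqP; rewrite -[_ == 0]negbK -cabs_gt0 -leNgt.
  by rewrite -(@ler_pXn2r _ 2) ?nnegrE ?cabs_ge0 // expr0n.
split=> //; split=> //.
rewrite eqd -att (mulrCA c) pnorm_reflect -mulrCA ce0 cabs0 expr0n mulr0 addr0.
by rewrite mulrCA.
Qed.

(** The truncation of p has degree below n, so a linear factor cannot push it past degree n. Used
    for X - w and for its reflection, this is why the quotient survives reflection. *)
Lemma take_poly_mul_linear n (l : {poly R[i]}) p : (size l <= 2)%N -> p`_n = 0 ->
  take_poly n.+1 (l * p) = l * take_poly n.+1 p.
Proof.
move=> sl pn0; rewrite -{1}(poly_take_drop n.+1 p) mulrDr mulrA take_polyDMXn //.
have st : (size (take_poly n.+1 p) <= n)%N.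
  apply/leq_sizeP => j; rewrite leq_eqVlt coef_take_poly => /predU1P[<-|nj].
    by rewrite ltnSn.
  by rewrite ltnNge nj.
apply: leq_trans (size_polyMleq _ _) _.
by rewrite -subn1 leq_subLR -addSnnS; exact: leq_add.
Qed.

Definition no_inner_root d := forall w, cabs w < 1 -> d.[w] != 0.

Lemma no_inner_root_neq0 d : no_inner_root d -> d != 0.
Proof.
move=> /(_ 0); rewrite cabs0 ltr01 => /(_ isT); apply: contraNneq => ->.
by rewrite horner0.
Qed.

(* Each inner root of [d] is reflected in the unit circle; the quotient
   [take_poly n.+1 (c * d) / d] does not change. *)
Lemma maximal_no_inner_root n mu c d : d != 0 -> (size d <= n.+1)%N ->
  maximal n.+1 mu c d ->
  exists d', [/\ no_inner_root d', (size d' <= n.+1)%N, maximal n.+1 mu c d' &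
    take_poly n.+1 (c * d) * d' = take_poly n.+1 (c * d') * d].
Proof.
move=> d0 sd md.
(* The induction runs on a factor g that still has to be cleaned, since reflecting a root need not
   lower the degree of the whole product; q collects the reflected factors. *)
have [g [q [dE qP]]] : exists g q, d = g * q /\ no_inner_root q.
  exists d, 1; rewrite mulr1; split=> // w _.
  by rewrite hornerE oner_eq0.
rewrite {d}dE in d0 sd md *.
have [m] := ubnP (size g); elim: m g q qP d0 sd md => // m IH g q qP d0 sd md sg.
case: (pselect (exists2 w, cabs w < 1 & root g w)) => [|noroot]; last first.
  exists (g * q); split=> // w w1; rewrite hornerM mulf_neq0 ?qP //.
  by apply/negP => gw; apply: noroot; exists w.
move=> [w w1 /factor_theorem[g1 gE]].
have g0 : g != 0 by apply: contraNneq d0 => ->; rewrite mul0r.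
have g10 : g1 != 0 by apply: contraNneq g0; rewrite gE => ->; rewrite mul0r.
have q0 := no_inner_root_neq0 qP.
have dE : g * q = ('X - w%:P) * (g1 * q) by rewrite gE -mulrA mulrCA.
have e0 : g1 * q != 0 by rewrite mulf_neq0.
have se : (size (g1 * q)%R <= n)%N.
  by move: sd; rewrite dE (mulrC ('X - _)) (size_Mmonic e0) ?monicXsubC // size_XsubC addn2.
rewrite dE in md *.
have [md' ce0] := maximal_reflect w1 se md.
have sl : (size (1 - w^* *: 'X : {poly R[i]})%R <= 2)%N.
  apply: leq_trans (size_polyD _ _) _; rewrite size_polyN size_poly1 geq_max /=.
  by apply: leq_trans (size_scale_leq _ _) _; rewrite size_polyX.
(* A root z of the reflected factor would satisfy conj(w) z = 1, impossible when both moduli are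
   below 1. *)
have lP : no_inner_root (1 - w^* *: 'X).
  move=> z z1; rewrite !hornerE subr_eq0 eq_sym; apply/eqP => wz.
  have : cabs (w^* * z) < 1.
    rewrite ComplexField.Normc.normcM cabsJ.
    by apply: le_lt_trans z1; rewrite ler_piMl ?cabs_ge0 // ltW.
  by rewrite wz ComplexField.Normc.normc1 ltxx.
have d'E : (1 - w^* *: 'X) * (g1 * q) = g1 * ((1 - w^* *: 'X) * q) by rewrite mulrCA.
have d'0 : (1 - w^* *: 'X) * (g1 * q) != 0.
  by rewrite mulf_neq0 // no_inner_root_neq0.
have [||||| d'' [d''P sd'' md'' d''E]] := IH g1 ((1 - w^* *: 'X) * q).
- by move=> z z1; rewrite hornerM mulf_neq0 ?qP ?lP.
- by rewrite -d'E.
- rewrite -d'E; apply: leq_trans (size_polyMleq _ _) _.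
  by rewrite -subn1 leq_subLR -addSnnS; exact: leq_add.
- by rewrite -d'E.
- by move: sg; rewrite gE size_Mmonic ?monicXsubC // size_XsubC addn2 /= ltnS.
(* The two proportions compose after multiplication by the reflected polynomial; [ce0] lets each
   linear factor leave the truncation. *)
exists d''; split=> //; apply: (mulfI d'0); move: d''E; rewrite -d'E.
rewrite !(mulrCA c (_ - _)) !(take_poly_mul_linear _ ce0) ?size_XsubC // => d''E.
transitivity (('X - w%:P) * (g1 * q) * ((1 - w^* *: 'X) * take_poly n.+1 (c * (g1 * q)) * d'')).
  by ring.
by rewrite d''E; ring.
Qed.

End ReflectedRoots.

(** * Cancelling the roots on the circle *)

Section CircleRoots.
Context {R : rcfType}.
Implicit Types (mu : R) (b c d p q s : {poly R[i]}) (w z : R[i]).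

Lemma horner_bounded p :
  exists2 K, 0 <= K & forall z, cabs z <= 1 -> cabs p.[z] <= K.
Proof.
elim/poly_ind: p => [|p x [K K0 IH]].
  by exists 0 => // z _; rewrite horner0 cabs0.
exists (K + cabs x); first by rewrite addr_ge0 ?cabs_ge0.
move=> z z1; rewrite hornerMXaddC; apply: le_trans (le_normcD _ _) _.
rewrite lerD2r ComplexField.Normc.normcM -[K]mulr1.
by apply: ler_pM; rewrite ?cabs_ge0 ?IH.
Qed.

(** The polynomial p - p(w) is X - w times a quotient bounded on the disc; the difference of squares
    contributes a further bounded factor. *)
Lemma cabs2_horner_lipschitz p w : cabs w <= 1 ->
  exists2 K, 0 <= K & forall z, cabs z <= 1 ->
    `|cabs p.[z] ^+ 2 - cabs p.[w] ^+ 2| <= K * cabs (z - w).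
Proof.
move=> w1; have [K K0 HK] := horner_bounded p.
have /factor_theorem[q qE] : root (p - p.[w]%:P) w by rewrite rootE !hornerE subrr.
have [L L0 HL] := horner_bounded q.
exists (L * (K + K)) => [|z z1]; first by rewrite mulr_ge0 // addr_ge0.
rewrite subr_sqr normrM mulrAC; apply: ler_pM => //; last first.
  by rewrite ger0_norm ?addr_ge0 ?cabs_ge0 // lerD ?HK.
have pE : p.[z] - p.[w] = q.[z] * (z - w).
  by have := congr1 (fun r => r.[z]) qE; rewrite !hornerE.
apply: le_trans (_ : cabs (p.[z] - p.[w]) <= _).
  exact: (@ler_dist_dist _ (Rcomplex R)).
by rewrite pE ComplexField.Normc.normcM ler_wpM2r ?cabs_ge0 ?HL.
Qed.

(** Over a real closed field the rational parametrization of the circle replaces the exponential: u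
    is a point near 1, and w is rotated by u. *)
Lemma circle_accumulation w (eps : R) : cabs w = 1 -> 0 < eps ->
  exists z, [/\ cabs z = 1, z != w & cabs (z - w) <= eps].
Proof.
(* With this t, |u - 1|^2 = 4 t^2 / (1 + t^2) is at most eps^2. *)
move=> w1 e0; pose t := eps / 2; have t0 : 0 < t by rewrite divr_gt0.
have w0 : w != 0 by rewrite -cabs_gt0 w1.
have s0 : 0 < 1 + t ^+ 2 by rewrite ltr_pwDl // sqr_ge0.
pose u : R[i] := ((1 - t ^+ 2) / (1 + t ^+ 2)) +i* (2 * t / (1 + t ^+ 2)).
have u1 : cabs u = 1.
  apply: (@pexpIrn _ 2); rewrite ?nnegrE ?cabs_ge0 // cabs2E /= expr1n.
  by field; rewrite gt_eqF.
have uB : cabs (u - 1) ^+ 2 = 4 * t ^+ 2 / (1 + t ^+ 2).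
  by rewrite cabs2E /=; field; rewrite gt_eqF.
have zwE : w * u - w = w * (u - 1) by rewrite mulrBr mulr1.
exists (w * u); split; first by rewrite ComplexField.Normc.normcM w1 u1 mul1r.
- rewrite -subr_eq0 zwE mulf_neq0 // -cabs_gt0 -(@ltr_pXn2r _ 2) ?nnegrE ?cabs_ge0 //.
  by rewrite uB expr0n /= divr_gt0 // mulr_gt0 // exprn_gt0.
- rewrite zwE ComplexField.Normc.normcM w1 mul1r cabs_le_sqr ?(ltW e0) // uB.
  rewrite ler_pdivrMr // (_ : eps = 2 * t) ?exprMn; last by rewrite /t; field.
  by have := sqr_ge0 (t ^+ 2); nra.
Qed.

(** Extension by continuity to a point of the circle; after a factor X - w has been cancelled, the
    identity is known only away from w. *)
Lemma cabs2_horner_eq_circle mu p q w : cabs w = 1 ->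
  (forall z, cabs z = 1 -> z != w -> cabs p.[z] ^+ 2 = mu * cabs q.[z] ^+ 2) ->
  cabs p.[w] ^+ 2 = mu * cabs q.[w] ^+ 2.
Proof.
move=> w1 H; have lew : cabs w <= 1 by rewrite w1.
have [K K0 HK] := cabs2_horner_lipschitz p lew.
have [L L0 HL] := cabs2_horner_lipschitz q lew.
apply/eqP; rewrite -subr_eq0 -normr_le0; apply/ler_addgt0Pr => e e0; rewrite add0r.
have M0 : 0 < K + `|mu| * L + 1 by rewrite ltr_wpDl // addr_ge0 // mulr_ge0.
have [z [z1 zw zle]] := circle_accumulation w1 (divr_gt0 e0 M0).
have lez : cabs z <= 1 by rewrite z1.
have -> : cabs p.[w] ^+ 2 - mu * cabs q.[w] ^+ 2 =
  mu * (cabs q.[z] ^+ 2 - cabs q.[w] ^+ 2) - (cabs p.[z] ^+ 2 - cabs p.[w] ^+ 2).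
  by rewrite (H z) //; ring.
apply: le_trans (ler_normB _ _) _; rewrite normrM.
apply: le_trans (lerD (ler_wpM2l (normr_ge0 mu) (HL z lez)) (HK z lez)) _.
rewrite mulrA -mulrDl addrC; move: zle; rewrite ler_pdivlMr // => zle.
apply: le_trans zle; rewrite mulrC ler_wpM2l ?cabs_ge0 //; lra.
Qed.

(* On the circle every root of [d] is a root of [b], and both are divided by it. *)
Lemma cancel_circle_roots m mu c b d s : no_inner_root d ->
  c * d = b + s * 'X^m ->
  (forall z, cabs z = 1 -> cabs b.[z] ^+ 2 = mu * cabs d.[z] ^+ 2) ->
  exists b' d' s', [/\ forall w, cabs w <= 1 -> d'.[w] != 0,
    c * d' = b' + s' * 'X^m & b * d' = b' * d].
Proof.
have [k] := ubnP (size d); elim: k b d s => // k IH b d s sd dP cdE bd.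
case: (pselect (exists2 w, cabs w = 1 & root d w)) => [|noroot]; last first.
  exists b, d, s; split=> // w; rewrite le_eqVlt => /predU1P[w1|]; last exact: dP.
  by apply/negP => dw; apply: noroot; exists w.
move=> [w w1 dw].
have /factor_theorem[b1 bE] : root b w.
  have := bd w w1; rewrite (rootP dw) cabs0 expr0n mulr0 => /eqP.
  by rewrite expf_eq0 /= => /eqP/ComplexField.Normc.eq0_normc/rootP.
(* Since w is not 0, X^m does not vanish there, so the root passes on to s. *)
have w0 : w != 0 by rewrite -cabs_gt0 w1.
have /factor_theorem[s1 sE] : root s w.
  have := congr1 (fun r => r.[w]) cdE; rewrite bE !hornerE (rootP dw) subrr.
  rewrite !mulr0 add0r => /esym/eqP; rewrite mulf_eq0 expf_eq0 (negPf w0) andbF orbF.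
  by [].
have [d1 dE] := factor_theorem _ _ dw.
have X0 : 'X - w%:P != 0 by rewrite polyXsubC_eq0.
have d10 : d1 != 0.
  by apply: contraNneq (no_inner_root_neq0 dP); rewrite dE => ->; rewrite mul0r.
have [|||| b' [d' [s' [d'P cd'E bd'E]]]] := IH b1 d1 s1.
- by move: sd; rewrite dE size_Mmonic ?monicXsubC // size_XsubC addn2 /= ltnS.
- by move=> z z1; have := dP z z1; rewrite dE hornerM mulf_eq0 negb_or => /andP[].
- by apply: (mulIf X0); rewrite -mulrA -dE cdE bE sE; ring.
- have off z : cabs z = 1 -> z != w -> cabs b1.[z] ^+ 2 = mu * cabs d1.[z] ^+ 2.
    move=> z1 zw; have := bd z z1; rewrite bE dE !hornerM !ComplexField.Normc.normcM.
    have X1 : cabs ('X - w%:P).[z] ^+ 2 != 0.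
      by rewrite expf_neq0 // gt_eqF // cabs_gt0 !hornerE subr_eq0.
    by rewrite !exprMn [RHS]mulrA => /(mulIf X1).
  move=> z z1; have [->|zw] := eqVneq z w; last exact: off.
  exact: cabs2_horner_eq_circle.
exists b', d', s'; split=> //.
by rewrite bE dE mulrAC bd'E; ring.
Qed.

(** Inner roots are reflected first, then circle roots are cancelled; the two proportions compose
    because the intermediate polynomial e is nonzero. *)
Lemma maximal_quotient n mu c d : d != 0 -> (size d <= n.+1)%N ->
  maximal n.+1 mu c d ->
  exists b' d' s', [/\ forall w, cabs w <= 1 -> d'.[w] != 0,
    c * d' = b' + s' * 'X^(n.+1) & take_poly n.+1 (c * d) * d' = b' * d].
Proof.
move=> d0 sd md; have [e [eP se me eE]] := maximal_no_inner_root d0 sd md.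
have [|z z1| b' [d' [s' [d'P cd'E bd'E]]]] :=
  @cancel_circle_roots n.+1 mu c (take_poly n.+1 (c * e)) e (drop_poly n.+1 (c * e)) eP.
- by rewrite poly_take_drop.
- by rewrite (maximal_cabs me z1) take_poly_id.
exists b', d', s'; split=> //; apply: (mulIf (no_inner_root_neq0 eP)).
by rewrite mulrAC eE mulrAC bd'E mulrAC.
Qed.

End CircleRoots.

(** * Top con-eigenvectors of complex symmetric matrices *)

Section Takagi.
Context {R : realType}.

Local Notation cj := (map_mx (@conjc R)).

Lemma sqnormE n (d : 'cV[R[i]]_n) : (sqnorm d)%:C%C = ((cj d)^T *m d) 0 0.
Proof.
rewrite mxE /sqnorm rmorph_sum /=; apply: eq_bigr => k _.
by rewrite !mxE mulrC mulJc.
Qed.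

Lemma sqnormZ n (x : R[i]) (d : 'cV[R[i]]_n) :
  sqnorm (x *: d) = cabs x ^+ 2 * sqnorm d.
Proof.
rewrite /sqnorm mulr_sumr; apply: eq_bigr => k _.
by rewrite mxE ComplexField.Normc.normcM exprMn.
Qed.

Lemma sqnormJ n (d : 'cV[R[i]]_n) : sqnorm (cj d) = sqnorm d.
Proof. by apply: eq_bigr => k _; rewrite mxE cabsJ. Qed.

Lemma sqnorm_ge0 n (d : 'cV[R[i]]_n) : 0 <= sqnorm d.
Proof. by apply: sumr_ge0 => k _; exact: sqr_ge0. Qed.

Lemma sqnorm_gt0 n (d : 'cV[R[i]]_n) : (0 < sqnorm d) = (d != 0).
Proof.
rewrite lt_neqAle sqnorm_ge0 andbT eq_sym; congr negb; apply/eqP/eqP => [d0|->].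
  apply/colP => k; rewrite mxE; apply: ComplexField.Normc.eq0_normc.
  have /(_ k isT)/eqP := psumr_eq0P (fun k _ => sqr_ge0 (cabs (d k 0))) d0.
  by rewrite expf_eq0 => /eqP.
by rewrite /sqnorm big1 // => k _; rewrite mxE cabs0 expr0n.
Qed.

Lemma map_conjcK m n (A : 'M[R[i]]_(m, n)) : cj (cj A) = A.
Proof. by apply/matrixP => i j; rewrite !mxE conjcK. Qed.

(** The Hermitian matrix S^* S is normal, hence unitarily diagonalizable, and the vector of its
    eigenbasis with the longest image under S attains the operator norm. *)
Lemma spectral_max n (S : 'M[R[i]]_n.+1) : exists (v : 'cV[R[i]]_n.+1) (lam : R), [/\ v != 0,
  0 <= lam, (cj S)^T *m S *m v = lam%:C *: v &
  forall p, sqnorm (S *m p) <= lam * sqnorm p].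
Proof.
set A := (cj S)^T *m S.
have AJ : (cj A)^T = A.
  by rewrite map_mxM trmx_mul -map_trmx trmxK map_conjcK.
have /orthomx_spectralP : A \is @normalmx R[i] n.+1.
  by apply/normalmxP; rewrite -map_trmx AJ.
set P := spectralmx A; set sp := spectral_diag A => AE.
have Pu : P \is unitarymx := spectral_unitarymx A.
have Pi : invmx P = (cj P)^T by rewrite invmx_unitary // map_trmx.
have PP : (cj P)^T *m P = 1%:M by rewrite -Pi mulVmx ?spectral_unit.
have PP' : P *m (cj P)^T = 1%:M by rewrite -Pi mulmxV ?spectral_unit.
have eigP p : A *m ((cj P)^T *m p) = (cj P)^T *m (diag_mx sp *m p).
  by rewrite {1}AE Pi -!mulmxA (mulmxA P) PP' mul1mx.
have normP p : sqnorm ((cj P)^T *m p) = sqnorm p.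
  apply: (@complexI R); rewrite !sqnormE map_mxM trmx_mul -map_trmx trmxK map_conjcK.
  by rewrite mulmxA -(mulmxA _ P) PP' mulmx1.
have qf p : (sqnorm (S *m p))%:C%C = ((cj p)^T *m (A *m p)) 0 0.
  by rewrite sqnormE map_mxM trmx_mul !mulmxA.
pose v j : 'cV[R[i]]_n.+1 := (cj P)^T *m delta_mx j 0.
have vE j : A *m v j = sp 0 j *: v j.
  rewrite eigP /v scalemxAr; congr (_ *m _).
  apply/matrixP => i k; rewrite mul_diag_mx !mxE.
  by case: eqVneq => [->|]; rewrite ?mulr0 //= mulr0.
have v1 j : sqnorm (v j) = 1.
  rewrite normP /sqnorm (bigD1 j) //= big1 => [|k kj]; rewrite !mxE eqxx.
    by rewrite addr0 ComplexField.Normc.normc1 expr1n.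
  by rewrite (negPf kj) cabs0 expr0n.
(* Each eigenvalue is the squared length of an image, so it is real and nonnegative and the largest
   one can be chosen in R. *)
have spE j : sp 0 j = (sqnorm (S *m v j))%:C%C.
  by rewrite qf vE -scalemxAr mxE -sqnormE v1 mulr1.
have [j _ jmax] := @arg_maxP _ _ _ 0 xpredT (fun j => sqnorm (S *m v j)) isT.
exists (v j), (sqnorm (S *m v j)); split.
- by rewrite -sqnorm_gt0 v1.
- exact: sqnorm_ge0.
- by rewrite vE spE.
move=> p; have -> : p = (cj P)^T *m (P *m p) by rewrite mulmxA PP mul1mx.
move: (P *m p) => {}p; rewrite normP.
have -> : sqnorm (S *m ((cj P)^T *m p)) =
    \sum_k sqnorm (S *m v k) * cabs (p k 0) ^+ 2.
  apply: (@complexI R).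
  rewrite qf eigP map_mxM trmx_mul -map_trmx trmxK map_conjcK mulmxA -(mulmxA _ P) PP'.
  rewrite mulmx1 mxE rmorph_sum; apply: eq_bigr => k _.
  by rewrite mul_diag_mx !mxE spE rmorphM /= -mulJc; ring.
rewrite /sqnorm mulr_sumr; apply: ler_sum => k _.
by apply: ler_wpM2r; [exact: sqr_ge0|exact: jmax].
Qed.

(* If [conj(S) S v = s^2 v], then [conj(S v) + s v] is a con-eigenvector of the
   symmetric matrix [S], unless it vanishes, in which case [v] is one. *)
Lemma takagi_max n (S : 'M[R[i]]_n.+1) : S^T = S ->
  exists (u : 'cV[R[i]]_n.+1) (sigma : R[i]), [/\ u != 0, S *m u = sigma *: cj u &
    forall p, sqnorm (S *m p) <= cabs sigma ^+ 2 * sqnorm p].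
Proof.
move=> Ssym; have [v [lam [v0 lam0 vE bnd]]] := spectral_max S.
have lamE (x : R[i]) : cabs x = Num.sqrt lam -> cabs x ^+ 2 = lam.
  by move=> ->; rewrite sqr_sqrtr.
pose s : R[i] := (Num.sqrt lam)%:C%C.
have s1 : cabs s = Num.sqrt lam by rewrite cabs_real ger0_norm // sqrtr_ge0.
have [u0|u0] := eqVneq (cj (S *m v) + s *: v) 0.
  exists v, (- s); split=> // [|p]; last by rewrite lamE ?normcN ?s1.
  move/(congr1 (map_mx (@conjc R))): u0; rewrite map_mxD map_conjcK map_mx0.
  move=> /(canRL (addrK _)); rewrite sub0r => ->.
  by rewrite map_mxZ /= oppr0 scaleNr.
exists (cj (S *m v) + s *: v), s; split=> // [|p]; last by rewrite lamE.
rewrite mulmxDr map_mxD map_conjcK map_mxZ /= oppr0 scalerDr -scalemxAr scalerA addrC.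
congr (_ + _); rewrite -[LHS]map_conjcK map_mxM map_conjcK.
move: vE; rewrite map_trmx Ssym -mulmxA => ->; rewrite map_mxZ /= oppr0; congr (_ *: _).
by rewrite -rmorphM /= -expr2 sqr_sqrtr.
Qed.

End Takagi.

(** * From the candidates to maximality over all polynomials *)

Section Candidates.
Context {R : realType} (N : nat).
Implicit Types (a d : 'cV[R[i]]_N.+1).

Definition coef_poly_of d : {poly R[i]} := \poly_(i < N.+1) d (inord i) 0.

(* Multiplication by this polynomial modulo ['X^(N.+1)] is [opAt a]. *)
Definition rev_poly_of a : {poly R[i]} := \poly_(i < N.+1) a (inord (N - i)) 0.

Lemma size_coef_poly_of d : (size (coef_poly_of d) <= N.+1)%N.
Proof. exact: size_poly. Qed.

Lemma coef_poly_ofE d (k : 'I_N.+1) : (coef_poly_of d)`_k = d k 0.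
Proof. by rewrite coef_poly ltn_ord inord_val. Qed.

Lemma coef_poly_of_neq0 d : d != 0 -> coef_poly_of d != 0.
Proof.
apply: contraNneq => d0; apply/eqP/colP => k.
by rewrite -coef_poly_ofE d0 coef0 mxE.
Qed.

Lemma opAtE a d (k : 'I_N.+1) :
  opAt a d k 0 = (rev_poly_of a * coef_poly_of d)`_k.
Proof.
rewrite mxE coefMr (big_ord_widen N.+1 (fun j =>
  (rev_poly_of a)`_(k - j) * (coef_poly_of d)`_j)) //.
apply: eq_big => [u|u uk]; first by rewrite ltnS.
rewrite coef_poly_ofE coef_poly (leq_ltn_trans (leq_subr _ _) (ltn_ord k)).
by rewrite subnBA // addnC addnBA ?(ltnW (ltn_ord k)) 1?addnC // -ltnS.
Qed.

(** Reversing the output index turns the Hankel matrix of [opA] into the lower triangular Toeplitz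
    matrix of [opAt], so both images have the same norm. *)
Lemma opAE a d (k : 'I_N.+1) : opA a d k 0 = opAt a d (rev_ord k) 0.
Proof.
rewrite !mxE; apply: eq_big => [l|l _] /=.
  by rewrite subSS leq_subRL -1?ltnS.
by rewrite subSS subKn -1?ltnS.
Qed.

Lemma sqnorm_opAt a d : sqnorm (opAt a d) = sqnorm (opA a d).
Proof.
rewrite /sqnorm (reindex_inj rev_ord_inj).
by apply: eq_bigr => k _; rewrite opAE.
Qed.

Lemma sqnorm_pnorm d : sqnorm d = pnorm N.+1 (coef_poly_of d).
Proof. by apply: eq_bigr => k _; rewrite coef_poly_ofE. Qed.

Lemma sqnorm_opAt_pnorm a d :
  sqnorm (opAt a d) = pnorm N.+1 (rev_poly_of a * coef_poly_of d).
Proof. by apply: eq_bigr => k _; rewrite opAtE. Qed.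

(** The Hankel matrix of [opA] is symmetric, so a con-eigenvector attains its norm; rescaled to
    squared norm [P0], it is a candidate of the first kind. *)
Lemma opA_le_candidates a (P0 m : R) d : 0 < P0 ->
  (forall d', candidate a P0 d' -> sqnorm (opA a d') <= m * P0) ->
  sqnorm (opA a d) <= m * sqnorm d.
Proof.
move=> P00 cand.
pose S := \matrix_(k < N.+1, l < N.+1)
  (if (k + l <= N)%N then a (inord (k + l)) 0 else 0).
have SE d' : opA a d' = S *m d'.
  apply/colP => k; rewrite !mxE [in LHS]big_mkcond /=.
  by apply: eq_bigr => l _; rewrite mxE; case: ifP; rewrite ?mul0r.
have [|u [s [u0 uE bnd]]] := @takagi_max R N S.
  by apply/matrixP => k l; rewrite !mxE addnC.
have un : 0 < sqnorm u by rewrite sqnorm_gt0.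
pose t : R := Num.sqrt (P0 / sqnorm u).
have t2 : cabs t%:C%C ^+ 2 * sqnorm u = P0.
  by rewrite cabs_real real_normK ?num_real // sqr_sqrtr ?divfK ?gt_eqF // divr_ge0 // ltW.
have := cand (t%:C%C *: u); rewrite SE -scalemxAr uE !sqnormZ sqnormJ mulrCA t2.
rewrite ler_pM2r // => sm; rewrite SE; apply: le_trans (bnd d) _.
rewrite ler_wpM2r ?sqnorm_ge0 // sm //; split; first by rewrite sqnormZ t2.
left; exists s; rewrite SE -scalemxAr uE map_mxZ /= oppr0 !scalerA.
by congr (_ *: _); rewrite mulrC.
Qed.

Lemma candidates_maximal a d0 (P0 nu : R) : 0 < P0 -> sqnorm d0 = P0 ->
  (forall d, candidate a P0 d -> sqnorm (opA a d) <= sqnorm (opA a d0)) ->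
  sqnorm (opA a d0) = nu ^+ 2 * P0 ->
  maximal N.+1 (nu ^+ 2) (rev_poly_of a) (coef_poly_of d0).
Proof.
move=> P00 d01 cand nuE; split; last first.
  by rewrite -sqnorm_opAt_pnorm sqnorm_opAt nuE -sqnorm_pnorm d01.
(* Only the coefficients of q up to degree N enter either side, so q may be replaced by the vector
   of these. *)
move=> q; pose d : 'cV[R[i]]_N.+1 := \col_k q`_k.
have dE k : (k < N.+1)%N -> (coef_poly_of d)`_k = q`_k.
  by move=> kN; rewrite -[k]/(nat_of_ord (Ordinal kN)) coef_poly_ofE mxE.
have -> : pnorm N.+1 q = sqnorm d by apply: eq_bigr => k _; rewrite mxE.
have -> : pnorm N.+1 (rev_poly_of a * q) = sqnorm (opA a d).
  rewrite -sqnorm_opAt sqnorm_opAt_pnorm; apply: eq_bigr => k _.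
  rewrite !coefMr; congr (cabs _ ^+ 2); apply: eq_bigr => j _.
  by rewrite dE // (leq_trans (ltn_ord j)) // ltn_ord.
apply: opA_le_candidates P00 _ => d' /cand; by rewrite nuE.
Qed.

End Candidates.

(** * Exponentials on the real line *)

Section Expi.
Context {R : realType}.
Implicit Types (x y : R).

Lemma expiD x y : expi (x + y) = expi x * expi y.
Proof.
rewrite /expi cosD sinD; apply/eqP; rewrite eq_complex /=.
by apply/andP; split; apply/eqP; ring.
Qed.

Lemma expi0 : expi (0 : R) = 1.
Proof. by rewrite /expi cos0 sin0. Qed.

Lemma conjc_expi x : (expi x)^* = expi (- x).
Proof. by rewrite /expi /= cosN sinN. Qed.

Lemma cabs_expi x : cabs (expi x) = 1.
Proof. by rewrite /= cos2Dsin2 sqrtr1. Qed.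

Lemma expi_neq0 x : expi x != 0.
Proof. by rewrite -cabs_gt0 cabs_expi. Qed.

Lemma expiMn n x : expi (n%:R * x) = expi x ^+ n.
Proof.
elim: n => [|n IH]; first by rewrite mul0r expi0.
by rewrite -natr1 mulrDl mul1r expiD IH exprSr.
Qed.

Lemma sin_natr_pi n : sin (n%:R * pi : R) = 0.
Proof.
elim: n => [|n IH]; first by rewrite mul0r sin0.
by rewrite -natr1 mulrDl mul1r sinDpi IH oppr0.
Qed.

Lemma sin_intr_pi (k : int) : sin (k%:~R * pi : R) = 0.
Proof.
case: (intP k) => [|n|n]; first by rewrite mul0r sin0.
  by rewrite -pmulrn sin_natr_pi.
by rewrite mulrNz -pmulrn mulNr sinN sin_natr_pi oppr0.
Qed.

End Expi.

(** * Continuity by real and imaginary parts *)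

Section ComplexContinuity.
Context {R : realType} {T : topologicalType}.
Implicit Types F G : T -> R[i].

Definition ccontinuous F : Prop :=
  continuous (fun x => complex.Re (F x)) /\ continuous (fun x => complex.Im (F x)).

Lemma ccontinuous_cst (c : R[i]) : ccontinuous (fun=> c).
Proof. by split=> x; exact: cvg_cst. Qed.

Lemma ccontinuousD F G : ccontinuous F -> ccontinuous G ->
  ccontinuous (fun x => F x + G x).
Proof.
move=> [F1 F2] [G1 G2]; split=> x.
  by under eq_fun do rewrite ReD; apply: cvgD; [exact: F1|exact: G1].
by under eq_fun do rewrite ImD; apply: cvgD; [exact: F2|exact: G2].
Qed.

Lemma ccontinuousM F G : ccontinuous F -> ccontinuous G ->
  ccontinuous (fun x => F x * G x).
Proof.
move=> [F1 F2] [G1 G2].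
have reM (u v : R[i]) : complex.Re (u * v) =
    complex.Re u * complex.Re v - complex.Im u * complex.Im v.
  by case: u; case: v.
have imM (u v : R[i]) : complex.Im (u * v) =
    complex.Re u * complex.Im v + complex.Im u * complex.Re v.
  by case: u; case: v.
split=> x.
  by under eq_fun do rewrite reM; apply: cvgB; apply: cvgM;
    [exact: F1|exact: G1|exact: F2|exact: G2].
by under eq_fun do rewrite imM; apply: cvgD; apply: cvgM;
    [exact: F1|exact: G2|exact: F2|exact: G1].
Qed.

Lemma ccontinuous_sum n (F : 'I_n -> T -> R[i]) : (forall i, ccontinuous (F i)) ->
  ccontinuous (fun x => \sum_(i < n) F i x).
Proof.
move=> cF; elim: n F cF => [|n IH] F cF.
  under eq_fun do rewrite big_ord0; exact: ccontinuous_cst.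
under eq_fun do rewrite big_ord_recr /=.
by apply: ccontinuousD; [exact: IH|exact: cF].
Qed.

Lemma ccontinuous_horner (p : {poly R[i]}) F : ccontinuous F ->
  ccontinuous (fun x => p.[F x]).
Proof.
move=> cF; elim/poly_ind: p => [|p c IH].
  under eq_fun do rewrite horner0; exact: ccontinuous_cst.
under eq_fun do rewrite hornerMXaddC.
by apply: ccontinuousD; [exact: ccontinuousM|exact: ccontinuous_cst].
Qed.

Lemma continuous_cabs2 F : ccontinuous F -> continuous (fun x => cabs (F x) ^+ 2).
Proof.
move=> [F1 F2] x; under eq_fun do rewrite cabs2E !expr2.
by apply: cvgD; apply: cvgM; solve [exact: F1|exact: F2].
Qed.

End ComplexContinuity.

Lemma ccontinuous_expi (R : realType) (k : R) :
  ccontinuous (fun x : R => expi (k * x)).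
Proof.
have kc : continuous (fun x : R => k * x) by move=> x; exact: mulrl_continuous.
by split=> x /=; apply: continuous_comp;
  solve [exact: kc|exact: continuous_cos|exact: continuous_sin].
Qed.

(** * Linearity of the complex integral *)

Section ComplexIntegral.
Context {R : realType} d {T : measurableType d}.
Variables (mu : {measure set T -> \bar R}) (D : set T).
Hypothesis mD : measurable D.
Implicit Types F G : T -> R[i].

Definition cintegrable F : Prop :=
  mu.-integrable D (EFin \o (fun x => complex.Re (F x))) /\
  mu.-integrable D (EFin \o (fun x => complex.Im (F x))).

Lemma eq_cintegral F G : F =1 G -> cintegral mu D F = cintegral mu D G.
Proof. by move=> /funext ->. Qed.

Lemma cintegrableD F G : cintegrable F -> cintegrable G ->
  cintegrable (fun x => F x + G x).
Proof.
move=> [F1 F2] [G1 G2]; split.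
  by apply: eq_integrable (integrableD mD F1 G1) => // x _ /=; rewrite ReD EFinD.
by apply: eq_integrable (integrableD mD F2 G2) => // x _ /=; rewrite ImD EFinD.
Qed.

Lemma cintegralD F G : cintegrable F -> cintegrable G ->
  cintegral mu D (fun x => F x + G x) = cintegral mu D F + cintegral mu D G.
Proof.
move=> [F1 F2] [G1 G2]; rewrite /cintegral.
under eq_Rintegral do rewrite ReD; under [X in _ +i* X]eq_Rintegral do rewrite ImD.
by rewrite !RintegralD.
Qed.

Lemma cintegrableZ (c : R[i]) F : cintegrable F -> cintegrable (fun x => c * F x).
Proof.
case: c => a b [F1 F2]; split.
  have := integrableB mD (integrableZl mD a F1) (integrableZl mD b F2).
  by apply: eq_integrable => // x _ /=; case: (F x).
have := integrableD mD (integrableZl mD a F2) (integrableZl mD b F1).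
by apply: eq_integrable => // x _ /=; case: (F x).
Qed.

Lemma cintegralZ (c : R[i]) F : cintegrable F ->
  cintegral mu D (fun x => c * F x) = c * cintegral mu D F.
Proof.
case: c => a b [F1 F2]; rewrite /cintegral.
have reE x : complex.Re ((a +i* b) * F x) = a * complex.Re (F x) - b * complex.Im (F x).
  by case: (F x).
have imE x : complex.Im ((a +i* b) * F x) = a * complex.Im (F x) + b * complex.Re (F x).
  by case: (F x).
under eq_Rintegral do rewrite reE.
under [X in _ +i* X]eq_Rintegral do rewrite imE.
have Z (r : R) (g : T -> R) : mu.-integrable D (EFin \o g) ->
    mu.-integrable D (EFin \o (fun x => r * g x)).
  by move=> iG; apply: eq_integrable (integrableZl mD r iG) => // x _ /=; rewrite EFinM.
by rewrite RintegralB ?RintegralD ?RintegralZl //; exact: Z.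
Qed.

Lemma cintegrable0 : cintegrable (fun=> 0).
Proof. by split; apply: eq_integrable (integrable0 mu D). Qed.

Lemma cintegrable_sum n (F : 'I_n -> T -> R[i]) : (forall i, cintegrable (F i)) ->
  cintegrable (fun x => \sum_(i < n) F i x).
Proof.
move=> iF; elim: n F iF => [|n IH] F iF.
  by under eq_fun do rewrite big_ord0; exact: cintegrable0.
under eq_fun do rewrite big_ord_recr /=.
by apply: cintegrableD; [exact: IH|exact: iF].
Qed.

Lemma cintegral_sum n (F : 'I_n -> T -> R[i]) : (forall i, cintegrable (F i)) ->
  cintegral mu D (fun x => \sum_(i < n) F i x) = \sum_(i < n) cintegral mu D (F i).
Proof.
move=> iF; elim: n F iF => [|n IH] F iF.
  rewrite big_ord0; under eq_cintegral do rewrite big_ord0.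
  by rewrite /cintegral !Rintegral_cst //= !mul0r.
rewrite big_ord_recr /=; under eq_cintegral do rewrite big_ord_recr /=.
rewrite cintegralD ?IH //; exact: cintegrable_sum.
Qed.

End ComplexIntegral.

(** * Fourier coefficients and Parseval's identity *)

Section TrigonometricMeans.
Context {R : realType}.

Local Notation leb := (@lebesgue_measure R).

Lemma measurable_circle : measurable (@circle R).
Proof. exact: measurable_itv. Qed.

Lemma continuous_integrable_circle (f : R -> R) : continuous f ->
  leb.-integrable (@circle R) (EFin \o f).
Proof.
move=> cf; apply: continuous_compact_integrable; first exact: segment_compact.
exact: continuous_subspaceT.
Qed.

Lemma ccontinuous_cintegrable (F : R -> R[i]) : ccontinuous F ->
  cintegrable leb (@circle R) F.
Proof. by move=> [F1 F2]; split; exact: continuous_integrable_circle. Qed.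

Lemma Rintegral_circle_derive (f F : R -> R) : continuous f ->
  (forall x : R, is_derive x (1 : R) F (f x)) ->
  \int[leb]_(x in @circle R) f x = F pi - F (- pi).
Proof.
move=> cf dF; have pi0 := @pi_gt0 R.
have cF : continuous F.
  by move=> x; apply: differentiable_continuous; apply/derivable1_diffP; exact: ex_derive.
rewrite /Rintegral (@continuous_FTC2 R f F) //.
- by rewrite gtrN.
- exact: continuous_subspaceT.
- split; first by move=> x _; exact: ex_derive.
  + by apply: cvg_at_right_filter; exact: cF.
  + by apply: cvg_at_left_filter; exact: cF.
- by move=> x _; rewrite derive1E derive_val.
Qed.

Lemma is_derive_scaled (f : R -> R) (c k df x : R) :
  is_derive (k * x) (1 : R) f df ->
  is_derive x (1 : R) (fun y : R => c * f (k * y)) (c * (df * k)).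
Proof.
move=> Df; apply: (@is_deriveZ R R R (fun y : R => f (k * y)) c x 1 (df * k)).
apply: (@is_derive1_comp _ f (fun y => k * y)).
by apply: is_derive_eq; rewrite /GRing.scale /= mulr1.
Qed.

Lemma Rintegral_cos (k : R) : k != 0 ->
  \int[leb]_(x in @circle R) cos (k * x) = 2 * sin (k * pi) / k.
Proof.
move=> k0; have Df (x : R) : is_derive x (1 : R) (fun y : R => k^-1 * sin (k * y)) (cos (k * x)).
  by rewrite -[cos _](mulKf k0) -[k * cos _]mulrC; exact: is_derive_scaled.
have [cc _] := ccontinuous_expi k; rewrite (Rintegral_circle_derive cc Df).
by rewrite mulrN sinN; field.
Qed.

Lemma Rintegral_sin (k : R) : k != 0 ->
  \int[leb]_(x in @circle R) sin (k * x) = 0.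
Proof.
move=> k0; have Df (x : R) : is_derive x (1 : R) (fun y : R => - k^-1 * cos (k * y)) (sin (k * x)).
  have -> : sin (k * x) = - k^-1 * (- sin (k * x) * k) by field.
  exact: is_derive_scaled.
have [_ cs] := ccontinuous_expi k; rewrite (Rintegral_circle_derive cs Df).
by rewrite mulrN cosN subrr.
Qed.

(** Orthogonality of the exponentials: for nonzero k the antiderivatives agree at both ends, as the
    sine vanishes at integer multiples of pi and the cosine is even. *)
Lemma circle_cmean_expi (k : int) :
  circle_cmean (fun x : R => expi (k%:~R * x)) = (k == 0)%:R.
Proof.
have pi0 : (pi : R) != 0 by rewrite gt_eqF ?pi_gt0.
rewrite /circle_cmean /cintegral /=; case: eqVneq => [->|k0].
  under eq_Rintegral do rewrite mul0r cos0.
  under [X in _ +i* X]eq_Rintegral do rewrite mul0r sin0.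
  have mass : leb (@circle R) = (2 * pi)%:E.
    rewrite /circle lebesgue_measure_itv /= lte_fin gtrN ?pi_gt0 //.
    by rewrite -EFinB opprK -mulr2n mulr_natl.
  have cstE (c : R) : \int[leb]_(x in @circle R) c = c * (2 * pi).
    rewrite Rintegral_cst; last exact: measurable_circle.
    by congr (_ * _); exact: (congr1 fine mass).
  rewrite !cstE mul0r mul1r complexr0 -rmorphM mulVf ?rmorph1 //.
  by rewrite mulf_neq0 ?pnatr_eq0.
rewrite Rintegral_cos ?Rintegral_sin ?intr_eq0 // sin_intr_pi.
by apply/eqP; rewrite eq_complex /= !(mulr0, mul0r) subr0 addr0 eqxx.
Qed.

Lemma circle_cmeanZ c (F : R -> R[i]) : ccontinuous F ->
  circle_cmean (fun x => c * F x) = c * circle_cmean F.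
Proof.
move=> cF; rewrite /circle_cmean cintegralZ; first by rewrite mulrCA.
  exact: measurable_circle.
exact: ccontinuous_cintegrable.
Qed.

Lemma circle_cmean_sum n (F : 'I_n -> R -> R[i]) : (forall i, ccontinuous (F i)) ->
  circle_cmean (fun x => \sum_(i < n) F i x) = \sum_(i < n) circle_cmean (F i).
Proof.
move=> cF; rewrite /circle_cmean cintegral_sum ?mulr_sumr //.
  exact: measurable_circle.
by move=> i; exact: ccontinuous_cintegrable.
Qed.

(** The square is expanded and integrated term by term. The case k = 0 gives Parseval's identity,
    general k the covariances of a moving average. *)
Lemma circle_cmean_expi_cabs2 n (c : 'I_n -> R[i]) (k : int) :
  circle_cmean (fun x => expi (k%:~R * x) *
    (cabs (\sum_(m < n) c m * expi (- (m%:R * x))) ^+ 2)%:C) =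
  \sum_(m < n) \sum_(l < n) c m * (c l)^* * (k - m%:Z + l%:Z == 0)%:R.
Proof.
have termE x : expi (k%:~R * x) *
    (cabs (\sum_(m < n) c m * expi (- (m%:R * x))) ^+ 2)%:C =
    \sum_(m < n) \sum_(l < n) c m * (c l)^* * expi ((k - m%:Z + l%:Z)%:~R * x).
  rewrite -mulJc rmorph_sum mulr_suml mulr_sumr; apply: eq_bigr => m _.
  rewrite mulr_sumr mulr_sumr; apply: eq_bigr => l _.
  rewrite rmorphM /= -/(expi _) conjc_expi opprK intrD intrB -!pmulrn mulrDl mulrBl !expiD.
  by ring.
under eq_fun do rewrite termE.
have cexp (z : R[i]) (j : int) : ccontinuous (fun x : R => z * expi (j%:~R * x)).
  by apply: ccontinuousM; [exact: ccontinuous_cst|exact: ccontinuous_expi].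
rewrite circle_cmean_sum => [|m]; last by apply: ccontinuous_sum => l.
apply: eq_bigr => m _; rewrite circle_cmean_sum //.
apply: eq_bigr => l _; rewrite circle_cmeanZ ?circle_cmean_expi //.
exact: ccontinuous_expi.
Qed.

Lemma circle_meanE (f : R -> R) : continuous f ->
  circle_mean f = (complex.Re (circle_cmean (fun x => (f x)%:C)))%:E.
Proof.
move=> cf; rewrite /circle_mean /circle_cmean /cintegral /=.
rewrite mul0r subr0 EFinM; congr (_ * _)%E.
rewrite /Rintegral fineK //; apply: integrable_fin_num.
  exact: measurable_circle.
exact: continuous_integrable_circle.
Qed.

Lemma circle_mean_parseval n (c : 'I_n -> R[i]) :
  circle_mean (fun x => cabs (\sum_(m < n) c m * expi (- (m%:R * x))) ^+ 2) =
  (\sum_(m < n) cabs (c m) ^+ 2)%:E.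
Proof.
rewrite circle_meanE.
  have := circle_cmean_expi_cabs2 c 0.
  under eq_fun do rewrite mul0r expi0 mul1r.
  move=> ->; congr EFin; rewrite Re_sum; apply: eq_bigr => m _.
  rewrite (bigD1 m) //= big1 => [|l lm].
    by rewrite sub0r addNr eqxx mulr1 mulJc addr0.
  rewrite -val_eqE /= in lm.
  by rewrite sub0r addrC subr_eq0 eqz_nat (negPf lm) mulr0.
apply: continuous_cabs2; apply: ccontinuous_sum => m.
apply: ccontinuousM; first exact: ccontinuous_cst.
by under eq_fun do rewrite -mulNr; exact: ccontinuous_expi.
Qed.

End TrigonometricMeans.

(** * Rational functions without poles in the closed disc *)

Section UniformApproximation.
Context {R : realType}.
Implicit Types (d p q : {poly R[i]}) (w z : R[i]).

(** Apart from the values outside the closed disc, this is membership in the disc algebra. *)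
Definition disc_approx (F : R[i] -> R[i]) : Prop :=
  forall e : R, 0 < e -> exists q, forall z, cabs z <= 1 -> cabs (F z - q.[z]) <= e.

Lemma disc_approxM (F G : R[i] -> R[i]) B : 0 <= B ->
  (forall z, cabs z <= 1 -> cabs (F z) <= B) ->
  disc_approx F -> disc_approx G -> disc_approx (fun z => F z * G z).
Proof.
move=> B0 FB aF aG e e0; have B1 : 0 < 2 * (B + 1) by rewrite mulr_gt0 // ltr_wpDl.
(* G is approximated first, because the bound of q sets the tolerance for F. *)
have [q Hq] := aG _ (divr_gt0 e0 B1).
have [K K0 HK] := horner_bounded q.
have K1 : 0 < 2 * (K + 1) by rewrite mulr_gt0 // ltr_wpDl.
have [p Hp] := aF _ (divr_gt0 e0 K1).
exists (p * q) => z z1; rewrite hornerM.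
have -> : F z * G z - p.[z] * q.[z] = F z * (G z - q.[z]) + (F z - p.[z]) * q.[z] by ring.
apply: le_trans (le_normcD _ _) _; rewrite !ComplexField.Normc.normcM.
have -> : e = (B + 1) * (e / (2 * (B + 1))) + e / (2 * (K + 1)) * (K + 1).
  by field; rewrite !gt_eqF // ltr_wpDl.
apply: lerD; apply: ler_pM; rewrite ?cabs_ge0 ?Hq ?Hp //.
  by apply: le_trans (FB _ z1) _; rewrite lerDl.
by apply: le_trans (HK _ z1) _; rewrite lerDl.
Qed.

Lemma cabs_sub_ge w z : cabs z <= 1 -> cabs w - 1 <= cabs (z - w).
Proof.
move=> z1; rewrite -[cabs (z - w)]normcN opprB.
apply: le_trans (@lerB_dist _ (Rcomplex R) w z : cabs w - cabs z <= cabs (w - z)).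
by rewrite lerB.
Qed.

(* The geometric series of [1 / (z - w)] in powers of [z / w]. *)
Lemma disc_approx_inv_linear w : 1 < cabs w -> disc_approx (fun z => (z - w)^-1).
Proof.
move=> w1 e e0; have w0 : w != 0 by rewrite -cabs_gt0 (lt_trans ltr01).
have r1 : `|(cabs w)^-1| < 1.
  by rewrite ger0_norm ?invr_ge0 ?cabs_ge0 // invf_lt1 // (lt_trans ltr01).
have W0 : 0 < cabs w - 1 by rewrite subr_gt0.
(* The remainder of the series is (z / w)^n / (z - w), where |z - w| is at least |w| - 1. *)
have [n Hn] : exists n, (cabs w)^-1 ^+ n <= e * (cabs w - 1).
  have /cvgrPdist_le/(_ _ (mulr_gt0 e0 W0)) [n _ Hn] := cvg_expr r1.
  exists n; have := Hn n (leqnn n); rewrite /= sub0r normrN ger0_norm //.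
  by rewrite exprn_ge0 // invr_ge0 cabs_ge0.
exists (\poly_(k < n) (- w^-1 ^+ k.+1)) => z z1.
have zw := cabs_sub_ge w z1.
have zw0 : z - w != 0 by rewrite -cabs_gt0 (lt_le_trans W0).
have -> : (z - w)^-1 - (\poly_(k < n) (- w^-1 ^+ k.+1)).[z] = (z / w) ^+ n / (z - w).
  apply: (mulIf zw0); rewrite divfK // mulrBl mulVf // horner_poly.
  have -> : \sum_(i < n) - w^-1 ^+ i.+1 * z ^+ i = - w^-1 * \sum_(i < n) (z / w) ^+ i.
    by rewrite mulr_sumr; apply: eq_bigr => i _; rewrite exprMn exprS; ring.
  have -> : - w^-1 * (\sum_(i < n) (z / w) ^+ i) * (z - w) =
      - ((z / w - 1) * \sum_(i < n) (z / w) ^+ i) by field.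
  by rewrite -subrX1; ring.
rewrite ComplexField.Normc.normcM ComplexField.Normc.normcV cabsX.
rewrite ler_pdivrMr ?(lt_le_trans W0) //.
apply: le_trans (_ : e * (cabs w - 1) <= _); last by rewrite ler_wpM2l // ltW.
apply: le_trans Hn; rewrite lerXn2r ?nnegrE ?invr_ge0 ?cabs_ge0 //.
rewrite ComplexField.Normc.normcM ComplexField.Normc.normcV.
by rewrite ler_piMl // invr_ge0 cabs_ge0.
Qed.

Lemma disc_approx_poly p : disc_approx (horner p).
Proof. by move=> e e0; exists p => z _; rewrite subrr cabs0 ltW. Qed.

(** All roots lie outside the closed disc, so the inverse is, up to a constant, a product of the
    inverses of the previous lemma. *)
Lemma disc_approx_inv d : (forall w, cabs w <= 1 -> d.[w] != 0) ->
  disc_approx (fun z => d.[z]^-1).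
Proof.
have [n] := ubnP (size d); elim: n d => // n IH d sd dP.
have [/size_poly1P[c c0 ->]|] := boolP (size d == 1).
  by move=> e e0; exists (c^-1)%:P => z _; rewrite !hornerC subrr cabs0 ltW.
move=> /closed_rootP[w dw]; have [d1 dE] := factor_theorem _ _ dw.
have w1 : 1 < cabs w.
  by rewrite ltNge; apply/negP => /dP/negP; apply.
have d0 : d != 0.
  by apply: contraNneq (dP 0 _) => [->|]; rewrite ?horner0 // cabs0.
have d10 : d1 != 0 by apply: contraNneq d0; rewrite dE => ->; rewrite mul0r.
have d1P z : cabs z <= 1 -> d1.[z] != 0.
  by move=> /dP; rewrite dE hornerM mulf_eq0 negb_or => /andP[].
have sd1 : (size d1 < n)%N.
  by move: sd; rewrite dE size_Mmonic ?monicXsubC // size_XsubC addn2 /= ltnS.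
have W0 : 0 < cabs w - 1 by rewrite subr_gt0.
have : disc_approx (fun z => (z - w)^-1 * d1.[z]^-1).
  apply: (@disc_approxM _ _ (cabs w - 1)^-1) (IH _ sd1 d1P).
  - by rewrite invr_ge0 ltW.
  - move=> z z1; rewrite ComplexField.Normc.normcV lef_pV2 ?posrE //.
      exact: cabs_sub_ge.
    rewrite cabs_gt0 subr_eq0; apply: contraTneq z1 => ->; by rewrite -ltNge.
  - exact: disc_approx_inv_linear.
move=> aD e e0; have [q Hq] := aD e e0; exists q => z z1.
by have := Hq z z1; rewrite dE !hornerE invfM mulrC.
Qed.

Lemma disc_approx_div p d : (forall w, cabs w <= 1 -> d.[w] != 0) ->
  disc_approx (fun z => p.[z] / d.[z]).
Proof.
move=> dP; have [K K0 HK] := horner_bounded p.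
apply: (disc_approxM K0 HK); [exact: disc_approx_poly|exact: disc_approx_inv].
Qed.

End UniformApproximation.

(** * Means of nonnegative functions, and null sets *)

Section CircleMean.
Context {R : realType}.
Implicit Types (f g : R -> R) (F G : R -> R[i]).

Local Notation leb := (@lebesgue_measure R).
Local Notation meas := (measurable_fun (@circle R)).
Local Notation nonneg f := (forall x : R, circle x -> 0 <= f x).

Lemma circle_mean_ge0 f : nonneg f -> (0 <= circle_mean f)%E.
Proof.
move=> f0; rewrite mule_ge0 // ?lee_fin ?invr_ge0 ?mulr_ge0 ?pi_ge0 //.
by apply: integral_ge0 => x cx; rewrite lee_fin f0.
Qed.

(** The exceptional set accommodates the zeros of [ma_poly], where [h_char] takes a default
    value. *)
Lemma circle_mean_le (Z : set R) f g : leb.-negligible Z ->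
  meas f -> meas g -> nonneg f -> nonneg g ->
  (forall x, circle x -> ~ Z x -> f x <= g x) ->
  (circle_mean f <= circle_mean g)%E.
Proof.
move=> nZ mf mg f0 g0 fg; apply: lee_wpmul2l.
  by rewrite lee_fin invr_ge0 mulr_ge0 ?pi_ge0.
apply: ae_ge0_le_integral.
- exact: measurable_circle.
- by move=> x cx; rewrite lee_fin f0.
- exact/measurable_EFinP.
- by move=> x cx; rewrite lee_fin g0.
- exact/measurable_EFinP.
- apply: negligibleS nZ => x /= H; apply: contrapT => Zx; apply: H => cx.
  by rewrite lee_fin fg.
Qed.

Lemma circle_meanZ (k : R) f : 0 <= k -> meas f -> nonneg f ->
  circle_mean (fun x => k * f x) = (k%:E * circle_mean f)%E.
Proof.
move=> k0 mf f0; rewrite /circle_mean muleCA; congr (_ * _)%E.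
have f0' x : circle x -> (0 <= (f x)%:E)%E by move=> cx; rewrite lee_fin f0.
rewrite -(@ge0_integralZl_EFin _ _ _ leb _ measurable_circle (EFin \o f)) //.
exact/measurable_EFinP.
Qed.

Lemma circle_meanD f g : meas f -> meas g -> nonneg f -> nonneg g ->
  circle_mean (fun x => f x + g x) = (circle_mean f + circle_mean g)%E.
Proof.
move=> mf mg f0 g0.
have f0' x : circle x -> (0 <= (f x)%:E)%E by move=> cx; rewrite lee_fin f0.
have g0' x : circle x -> (0 <= (g x)%:E)%E by move=> cx; rewrite lee_fin g0.
rewrite /circle_mean -ge0_muleDr ?integral_ge0 //; congr (_ * _)%E.
rewrite -(@ge0_integralD _ _ _ leb _ measurable_circle (EFin \o f) (EFin \o g)) //;
  exact/measurable_EFinP.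
Qed.

Lemma continuous_meas f : continuous f -> meas f.
Proof.
by move=> /continuous_measurable_fun mf; exact: measurable_funS mf.
Qed.

Lemma ccontinuous_cmeasurable F : ccontinuous F -> cmeasurable (@circle R) F.
Proof. by move=> [F1 F2]; split; exact: continuous_meas. Qed.

(** If exp(-ix) is a root w, then cos x is the real part of w, which leaves x = acos or -acos of it:
    finitely many points. *)
Lemma negligible_root (r : {poly R[i]}) : r != 0 ->
  leb.-negligible [set x | circle x /\ r.[expi (- x)] = 0].
Proof.
move=> r0; have [rs rE] := closed_field_poly_normal r.
pose s := [seq acos (complex.Re w) | w <- rs] ++ [seq - acos (complex.Re w) | w <- rs].
have s0 : leb.-negligible [set` s].
  exists [set` s]; split=> //; last first.
    by apply: countable_lebesgue_measure0; exact/finite_set_countable/finite_seq.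
  by apply: countable_measurable => [t|]; [exact: measurable_set1|exact/finite_set_countable/finite_seq].
apply: negligibleS s0 => x /= [].
rewrite /circle /= in_itv /= => /andP[x1 x2] /rootP.
have -> : root r (expi (- x)) = (expi (- x) \in rs).
  by rewrite {1}rE rootZ ?lead_coef_eq0 // root_prod_XsubC.
move=> xs; have Re_x : complex.Re (expi (- x)) = cos x by rewrite /= cosN.
rewrite /s mem_cat; apply/orP; have [x0|x0] := leP 0 x.
  by left; apply/mapP; exists (expi (- x)); rewrite ?Re_x ?cosK // in_itv /= x0.
right; apply/mapP; exists (expi (- x)); rewrite // Re_x -cosN cosK ?opprK //.
by rewrite in_itv /= oppr_ge0 (ltW x0) /= lerNl.
Qed.

End CircleMean.

(** * Measurability by real and imaginary parts *)

Section ComplexMeasurability.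
Context {R : realType} d {T : measurableType d}.
Variable D : set T.
Implicit Types F G : T -> R[i].

Lemma cmeasurable_sub F G : cmeasurable D F -> cmeasurable D G ->
  cmeasurable D (fun x => F x - G x).
Proof.
move=> [F1 F2] [G1 G2]; split.
  have := measurable_funB F1 G1; congr measurable_fun.
  by apply/funext => x /=; case: (F x); case: (G x).
have := measurable_funB F2 G2; congr measurable_fun.
by apply/funext => x /=; case: (F x); case: (G x).
Qed.

Lemma cmeasurable_mul F G : cmeasurable D F -> cmeasurable D G ->
  cmeasurable D (fun x => F x * G x).
Proof.
move=> [F1 F2] [G1 G2]; split.
  have := measurable_funB (measurable_funM F1 G1) (measurable_funM F2 G2).
  congr measurable_fun; apply/funext => x /=.
  by case: (F x); case: (G x).
have := measurable_funD (measurable_funM F1 G2) (measurable_funM F2 G1).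
congr measurable_fun; apply/funext => x /=.
by case: (F x); case: (G x).
Qed.

Lemma measurable_cabs2 F : cmeasurable D F ->
  measurable_fun D (fun x => cabs (F x) ^+ 2).
Proof.
move=> [F1 F2].
have := measurable_funD (measurable_funX 2 F1) (measurable_funX 2 F2).
by congr measurable_fun; apply/funext => x /=; rewrite cabs2E.
Qed.

Lemma cmeasurable_inv F : cmeasurable D F -> cmeasurable D (fun x => (F x)^-1).
Proof.
move=> mF; have m2 : measurable_fun D (fun x => (cabs (F x) ^+ 2)^-1).
  have := measurableT_comp (@measurable_powR R (-1)) (measurable_cabs2 mF).
  by congr measurable_fun; apply/funext => x /=; rewrite powR_inv1 // sqr_ge0.
case: mF => F1 F2; split.
  have := measurable_funM F1 m2; congr measurable_fun; apply/funext => x /=.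
  by rewrite cabs2E; case: (F x).
have := measurable_funN (measurable_funM F2 m2).
congr measurable_fun; apply/funext => x /=.
by rewrite cabs2E; case: (F x).
Qed.

End ComplexMeasurability.

(** * The extrapolation problem in the variable z = exp(-ix) *)

Section Extrapolation.
Context {R : realType} {N : nat}.
Implicit Types (a d : 'cV[R[i]]_N.+1) (f : R -> R) (g h : R -> R[i]) (x : R).

Local Notation meas := (measurable_fun (@circle R)).

Lemma ccontinuous_expiN : ccontinuous (fun x : R => expi (- x)).
Proof. by under eq_fun do rewrite -mulN1r; exact: ccontinuous_expi. Qed.

Lemma expiMnN n x : expi (- (n%:R * x)) = expi (- x) ^+ n.
Proof. by rewrite -mulrN expiMn. Qed.

Lemma expi_expiN n x : expi (n%:R * x) * expi (- x) ^+ n = 1.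
Proof. by rewrite -expiMnN -expiD subrr expi0. Qed.

Lemma ma_polyE d x : ma_poly d x = (coef_poly_of d).[expi (- x)].
Proof.
rewrite horner_poly; apply: eq_bigr => k _.
by rewrite inord_val expiMnN.
Qed.

(** The factor z^N clears the negative powers of z at the price of reversing the coefficients; the
    same is done in [opA_funE]. *)
Lemma A_funE a x : A_fun a x * expi (- x) ^+ N = (rev_poly_of a).[expi (- x)].
Proof.
rewrite horner_poly mulr_suml (reindex_inj rev_ord_inj); apply: eq_bigr => k _ /=.
have kN : (k <= N)%N by rewrite -ltnS.
rewrite subSS -[X in _ * _ ^+ X](subnK kN) exprD mulrA -(mulrA (a _ _)).
by rewrite expi_expiN mulr1; congr (a _ _ * _); apply: val_inj; rewrite /= inordK // ltnS leq_subr.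
Qed.

Lemma opA_funE a d x :
  (\sum_(k < N.+1) opA a d k 0 * expi (k%:R * x)) * expi (- x) ^+ N =
  (take_poly N.+1 (rev_poly_of a * coef_poly_of d)).[expi (- x)].
Proof.
rewrite horner_poly mulr_suml (reindex_inj rev_ord_inj); apply: eq_bigr => k _ /=.
have kN : (k <= N)%N by rewrite -ltnS.
rewrite subSS -[X in _ * _ ^+ X](subnK kN) exprD mulrA -(mulrA (opA _ _ _ _)).
by rewrite expi_expiN mulr1 opAE rev_ordK opAtE.
Qed.

Lemma past_polyE n (c : nat -> R[i]) x :
  past_poly n c x = expi (- x) * (\poly_(k < n) c k).[expi (- x)].
Proof.
rewrite horner_poly mulr_sumr; apply: eq_bigr => k _.
by rewrite expiMnN exprS mulrCA.
Qed.

Lemma ccontinuous_past_poly n (c : nat -> R[i]) : ccontinuous (@past_poly R n c).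
Proof.
have -> : @past_poly R n c =
    (fun x => expi (- x) * (\poly_(k < n) c k).[expi (- x)]).
  by apply/funext => x; exact: past_polyE.
by apply: ccontinuousM; [|apply: ccontinuous_horner]; exact: ccontinuous_expiN.
Qed.

Lemma ccontinuous_A_fun a : ccontinuous (A_fun a).
Proof.
apply: ccontinuous_sum => j.
by apply: ccontinuousM; [exact: ccontinuous_cst|exact: ccontinuous_expi].
Qed.

Lemma ccontinuous_ma_poly d : ccontinuous (ma_poly d).
Proof.
have -> : ma_poly d = (fun x => (coef_poly_of d).[expi (- x)]).
  by apply/funext => x; exact: ma_polyE.
by apply: ccontinuous_horner; exact: ccontinuous_expiN.
Qed.

Lemma cmeasurable_h_char a d : cmeasurable (@circle R) (h_char a d).
Proof.
apply: cmeasurable_sub.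
  exact/ccontinuous_cmeasurable/ccontinuous_A_fun.
apply: cmeasurable_mul.
  exact/cmeasurable_inv/ccontinuous_cmeasurable/ccontinuous_ma_poly.
apply: ccontinuous_cmeasurable; apply: ccontinuous_sum => k.
by apply: ccontinuousM; [exact: ccontinuous_cst|exact: ccontinuous_expi].
Qed.

Lemma measurable_error f g : meas f -> cmeasurable (@circle R) g ->
  meas (fun x => cabs (g x) ^+ 2 * f x).
Proof. by move=> mf /measurable_cabs2 mg; exact: measurable_funM. Qed.

Lemma circle_mean_horner n (r : {poly R[i]}) : (size r <= n)%N ->
  circle_mean (fun x => cabs r.[expi (- x)] ^+ 2) = (pnorm n r)%:E.
Proof.
move=> sr; rewrite -(circle_mean_parseval (fun m : 'I_n => r`_m)).
congr circle_mean; apply/funext => x; congr (cabs _ ^+ 2).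
by rewrite (horner_coef_wide _ sr); apply: eq_bigr => m _; rewrite expiMnN.
Qed.

Lemma ma_density_mean d : circle_mean (ma_density d) = (sqnorm d)%:E.
Proof.
rewrite sqnorm_pnorm -(circle_mean_horner (size_coef_poly_of d)).
by congr circle_mean; apply/funext => x; rewrite -ma_polyE.
Qed.

Lemma continuous_ma_density d : continuous (ma_density d).
Proof. exact: (continuous_cabs2 (ccontinuous_ma_poly d)). Qed.

Lemma ma_density_ge0 d x : 0 <= ma_density d x.
Proof. exact: sqr_ge0. Qed.

Lemma spectral_density_ma d : spectral_density (ma_density d).
Proof.
split; first by (apply: continuous_meas; exact: continuous_ma_density).
  by move=> x _; exact: ma_density_ge0.
by rewrite ma_density_mean ltry.
Qed.

Lemma negligible_ma_poly d : d != 0 ->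
  (@lebesgue_measure R).-negligible [set x | circle x /\ ma_poly d x = 0].
Proof.
move/coef_poly_of_neq0/negligible_root; congr (_.-negligible _).
by apply/seteqP; split => x /= [cx]; rewrite ma_polyE.
Qed.

Lemma A_fun_sub_h_char a d x : ma_poly d x != 0 ->
  (A_fun a x - h_char a d x) * ma_poly d x * expi (- x) ^+ N =
  (take_poly N.+1 (rev_poly_of a * coef_poly_of d)).[expi (- x)].
Proof.
move=> D0; rewrite -opA_funE; congr (_ * _).
by rewrite /h_char opprB addrC subrK [_^-1 * _]mulrC divfK.
Qed.

(** * The characteristic attached to a maximal vector *)

Section Maximal.
Variables (a d : 'cV[R[i]]_N.+1) (mu : R).
Hypothesis d0 : d != 0.
Hypothesis md : maximal N.+1 mu (rev_poly_of a) (coef_poly_of d).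

Lemma maximal_ge0 : 0 <= mu.
Proof.
have sd : 0 < sqnorm d by rewrite sqnorm_gt0.
have [_ att] := md; have := pnorm_ge0 N.+1 (rev_poly_of a * coef_poly_of d).
by rewrite att -sqnorm_pnorm pmulr_lge0.
Qed.

(** The equalizing property: up to a unimodular factor the error is b/d, and |b|^2 = mu |d|^2 on the
    circle. Its mean against f therefore depends on the mean of f alone. *)
Lemma cabs_A_fun_sub_h_char x : ma_poly d x != 0 ->
  cabs (A_fun a x - h_char a d x) ^+ 2 = mu.
Proof.
move=> D0; have := congr1 (fun z => cabs z ^+ 2) (A_fun_sub_h_char a D0).
rewrite (maximal_cabs md (cabs_expi _)) take_poly_id ?size_coef_poly_of // -ma_polyE.
rewrite !ComplexField.Normc.normcM cabsX cabs_expi expr1n mulr1 exprMn => /mulIf; apply.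
by rewrite expf_neq0 // gt_eqF // cabs_gt0.
Qed.

Lemma Delta_h_char f : spectral_density f ->
  Delta a (h_char a d) f = (mu%:E * circle_mean f)%E.
Proof.
move=> [mf f0 _]; rewrite -circle_meanZ ?maximal_ge0 //.
have merr : meas (fun x => cabs (A_fun a x - h_char a d x) ^+ 2 * f x).
  apply: measurable_error => //; apply: cmeasurable_sub (cmeasurable_h_char a d).
  exact/ccontinuous_cmeasurable/ccontinuous_A_fun.
have mmu : meas (fun x => mu * f x) by exact: measurable_funM.
have err0 x : circle x -> 0 <= cabs (A_fun a x - h_char a d x) ^+ 2 * f x.
  by move=> cx; rewrite mulr_ge0 ?sqr_ge0 ?f0.
have mu0 x : circle x -> 0 <= mu * f x by move=> cx; rewrite mulr_ge0 ?maximal_ge0 ?f0.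
have eq x : circle x -> ~ [set x | circle x /\ ma_poly d x = 0] x ->
    cabs (A_fun a x - h_char a d x) ^+ 2 * f x = mu * f x.
  move=> cx Dx; rewrite cabs_A_fun_sub_h_char //; apply/eqP => D0.
  by apply: Dx.
have nZ := negligible_ma_poly d0.
apply/eqP; rewrite eq_le /Delta /sqnorm_L2.
by rewrite !(circle_mean_le nZ) // => x cx Dx; rewrite eq.
Qed.

(** From c e = b + s z^(N+1), with b/e equal to the original quotient, one gets z^N h = c - b/e = s
    z^(N+1) / e. *)
Lemma h_char_quotient : exists s e : {poly R[i]},
  (forall w, cabs w <= 1 -> e.[w] != 0) /\
  forall x, ma_poly d x != 0 ->
    h_char a d x = expi (- x) * (s.[expi (- x)] / e.[expi (- x)]).
Proof.
have [b [e [s [eP ce be]]]] := maximal_quotient (coef_poly_of_neq0 d0) (size_coef_poly_of d) md.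
exists s, e; split=> // x D0; set z := expi (- x).
have z1 : cabs z <= 1 by rewrite cabs_expi.
have zN : z ^+ N != 0 by rewrite expf_neq0 // expi_neq0.
have e0 := eP z z1.
apply: (mulIf zN); apply: (mulIf e0); apply: (mulIf D0).
have E1 := A_fun_sub_h_char a D0; have E2 := A_funE a x.
have E3 := congr1 (fun p => p.[z]) ce; have E4 := congr1 (fun p => p.[z]) be.
rewrite !hornerE /= -?/z in E1 E2 E3 E4.
rewrite -ma_polyE -E1 in E4; rewrite -E2 in E3.
have E5 : (A_fun a x - h_char a d x) * z ^+ N * e.[z] = b.[z].
  by apply: (mulIf D0); rewrite -E4; ring.
have -> : z * (s.[z] / e.[z]) * z ^+ N * e.[z] = s.[z] * z ^+ N.+1.
  by rewrite exprS; field.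
congr (_ * _); apply: (addrI (b.[z])); rewrite -[RHS]E3 -E5; ring.
Qed.

(** Uniform approximation off a null set gives approximation in L_2(f) for every f of finite
    mean. *)
Lemma L2minus_h_char f : spectral_density f -> L2minus f (h_char a d).
Proof.
move=> [mf f0 finf].
have [s [e [eP hE]]] := h_char_quotient.
have nZ := negligible_ma_poly d0.
have approx (eps : R) : 0 < eps -> exists n c, forall x, ma_poly d x != 0 ->
    cabs (h_char a d x - past_poly n c x) <= eps.
  move=> eps0; have [q Hq] := disc_approx_div s eP eps0.
  (* The factor z of h matches the one in [past_poly], whose frequencies start at -1; only s/e has
     to be approximated. *)
  exists (size q), (nth 0 q) => x D0; rewrite hE // past_polyE coefK -mulrBr.
  by rewrite ComplexField.Normc.normcM cabs_expi mul1r Hq // cabs_expi.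
have merr n c : meas (fun x => cabs (h_char a d x - past_poly n c x) ^+ 2 * f x).
  apply: measurable_error => //; apply: cmeasurable_sub; first exact: cmeasurable_h_char.
  exact/ccontinuous_cmeasurable/ccontinuous_past_poly.
have bound g (K : R) : meas (fun x => cabs (g x) ^+ 2 * f x) ->
    (forall x, ma_poly d x != 0 -> cabs (g x) <= K) ->
    (sqnorm_L2 f g <= (K ^+ 2)%:E * circle_mean f)%E.
  move=> mg gK; rewrite -circle_meanZ ?sqr_ge0 //.
  apply: (circle_mean_le nZ) => //.
  - exact: measurable_funM.
  - by move=> x cx; rewrite mulr_ge0 ?sqr_ge0 ?f0.
  - by move=> x cx; rewrite mulr_ge0 ?sqr_ge0 ?f0.
  move=> x cx Dx; rewrite ler_wpM2r ?f0 // lerXn2r ?nnegrE ?cabs_ge0 //.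
    apply: le_trans (gK x _); first exact: cabs_ge0.
    by apply/eqP => D0; apply: Dx.
  by apply: gK; apply/eqP => D0; apply: Dx.
have fE : circle_mean f = (fine (circle_mean f))%:E.
  by rewrite fineK // ge0_fin_numE // circle_mean_ge0.
have m0 : 0 <= fine (circle_mean f) by rewrite fine_ge0 // circle_mean_ge0.
split.
  split; first exact: cmeasurable_h_char.
  have [n [c Hc]] := approx 1 ltr01.
  have [K K0 HK] := horner_bounded (\poly_(k < n) c k).
  apply: (@le_lt_trans _ _ (((1 + K) ^+ 2)%:E * circle_mean f)%E); last first.
    by rewrite fE -EFinM ltry.
  apply: bound => [|x D0]; first exact: (measurable_error mf (cmeasurable_h_char _ _)).
  rewrite -[h_char a d x](subrK (past_poly n c x)).
  apply: le_trans (le_normcD _ _) _; apply: lerD; first exact: Hc.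
  by rewrite past_polyE ComplexField.Normc.normcM cabs_expi mul1r HK // cabs_expi.
(* The uniform tolerance is the square root of t, so the squared norm is at most t times the mean of
   f; the + 1 covers mean 0. *)
move=> eps eps0; pose t := eps / (2 * (fine (circle_mean f) + 1)).
have t0 : 0 < t by rewrite divr_gt0 // mulr_gt0 // ltr_wpDl.
have st0 : 0 < Num.sqrt t by rewrite sqrtr_gt0.
have [n [c Hc]] := approx _ st0.
exists n, c; apply: le_lt_trans (bound _ _ (merr n c) Hc) _.
rewrite sqr_sqrtr ?ltW // fE -EFinM lte_fin /t mulrAC ltr_pdivrMr.
  by rewrite ltr_pM2l //; lra.
by rewrite mulr_gt0 // ltr_wpDl.
Qed.

(* Multiplied by z^N ma_poly d, the error of a past polynomial becomes a
   polynomial in z = expi (- x) that agrees with c d modulo z^(N+1). *)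
Lemma Delta_past_poly_ge n c :
  ((mu * sqnorm d)%:E <= Delta a (past_poly n c) (ma_density d))%E.
Proof.
pose r := rev_poly_of a * coef_poly_of d -
  'X^(N.+1) * (\poly_(k < n) c k * coef_poly_of d).
(* This length holds all of r, for Parseval, and at least its first N + 1 coefficients, which are
   those of c d. *)
have -> : Delta a (past_poly n c) (ma_density d) = (pnorm (maxn N.+1 (size r)) r)%:E.
  rewrite -(circle_mean_horner (leq_maxr _ _)); congr circle_mean; apply/funext => x.
  rewrite /ma_density -exprMn -ComplexField.Normc.normcM; congr (_ ^+ 2).
  have zN : cabs (expi (- x) ^+ N) = 1 by rewrite cabsX cabs_expi expr1n.
  rewrite -[LHS]mulr1 -zN -ComplexField.Normc.normcM; congr cabs.
  rewrite /r !hornerE /= -A_funE -ma_polyE past_polyE exprS; ring.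
rewrite lee_fin; have [_ att] := md; rewrite sqnorm_pnorm -att.
rewrite /pnorm (big_ord_widen (maxn N.+1 (size r))
  (fun k => cabs (rev_poly_of a * coef_poly_of d)`_k ^+ 2)) ?leq_maxl //.
rewrite big_mkcond; apply: ler_sum => k _; case: ifP => kN; last exact: sqr_ge0.
by rewrite /r coefB coefXnM kN subr0.
Qed.

(** The bound passes from polynomials of the past to their closure by [cabs2D_le]. *)
Lemma Delta_ge g : L2minus (ma_density d) g ->
  ((mu * sqnorm d)%:E <= Delta a g (ma_density d))%E.
Proof.
move=> [[mg _] gapp]; set m := mu * sqnorm d; set f := ma_density d.
have mf : meas f by (apply: continuous_meas; exact: continuous_ma_density).
have sq0 h x : circle x -> 0 <= cabs (h x) ^+ 2 * f x.
  by move=> _; rewrite mulr_ge0 ?sqr_ge0.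
have mA : cmeasurable (@circle R) (fun x => A_fun a x - g x).
  by apply: cmeasurable_sub => //; exact/ccontinuous_cmeasurable/ccontinuous_A_fun.
have D0 : (0 <= Delta a g f)%E by apply: circle_mean_ge0; exact: sq0.
have [Dfin|] := ltP (Delta a g f) +oo%E; last by apply: le_trans; rewrite leey.
have DE : Delta a g f = (fine (Delta a g f))%:E by rewrite fineK // ge0_fin_numE.
set dl := fine (Delta a g f) in DE.
have dl0 : 0 <= dl by rewrite fine_ge0.
rewrite DE lee_fin; apply/ler_addgt0Pr => eta eta0.
(* The slack eta is halved: t dl is at most eta/2, and e below is chosen with (1 + 1/t) e =
   eta/2. *)
pose t := eta / (2 * (dl + 1)); have dl1 : 0 < 2 * (dl + 1) by rewrite mulr_gt0 // ltr_wpDl.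
have t0 : 0 < t by rewrite divr_gt0.
have t1 : 0 < 1 + t^-1 by rewrite ltr_pwDl // invr_ge0 ltW.
pose e := eta / 2 / (1 + t^-1); have e0 : 0 < e by rewrite !divr_gt0.
have [n [c Hc]] := gapp e e0.
have mgp : cmeasurable (@circle R) (fun x => g x - past_poly n c x).
  by apply: cmeasurable_sub => //; exact/ccontinuous_cmeasurable/ccontinuous_past_poly.
have mAp : cmeasurable (@circle R) (fun x => A_fun a x - past_poly n c x).
  by apply: cmeasurable_sub; apply: ccontinuous_cmeasurable;
    [exact: ccontinuous_A_fun|exact: ccontinuous_past_poly].
have step : (Delta a (past_poly n c) f <=
    (1 + t)%:E * Delta a g f + (1 + t^-1)%:E * sqnorm_L2 f (fun x => (g x - past_poly n c x)%R))%E.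
  have c1 : 0 <= 1 + t by rewrite ltW // addr_gt0.
  have m1 := measurable_error mf mA; have m2 := measurable_error mf mgp.
  have n1 x (cx : circle x) := sq0 (fun x => A_fun a x - g x) x cx.
  have n2 x (cx : circle x) := sq0 (fun x => g x - past_poly n c x) x cx.
  have m1' : meas (fun x => (1 + t) * (cabs (A_fun a x - g x) ^+ 2 * f x)).
    exact: measurable_funM.
  have m2' : meas (fun x => (1 + t^-1) * (cabs (g x - past_poly n c x) ^+ 2 * f x)).
    exact: measurable_funM.
  have n1' x : circle x -> 0 <= (1 + t) * (cabs (A_fun a x - g x) ^+ 2 * f x).
    by move=> cx; exact: mulr_ge0 c1 (n1 x cx).
  have n2' x : circle x -> 0 <= (1 + t^-1) * (cabs (g x - past_poly n c x) ^+ 2 * f x).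
    by move=> cx; exact: mulr_ge0 (ltW t1) (n2 x cx).
  rewrite /Delta /sqnorm_L2 -circle_meanZ // -(circle_meanZ (ltW t1)) //.
  rewrite -circle_meanD //; apply: (@circle_mean_le _ set0) => //.
  - exact: negligible_set0.
  - exact: measurable_error.
  - exact: measurable_funD.
  - by move=> x cx; exact: (sq0 (fun x => A_fun a x - past_poly n c x)).
  - by move=> x cx; exact: addr_ge0 (n1' x cx) (n2' x cx).
  move=> x cx _; rewrite (mulrA (1 + t)) (mulrA (1 + t^-1)) -mulrDl ler_wpM2r ?sqr_ge0 //.
  have -> : A_fun a x - past_poly n c x = (A_fun a x - g x) + (g x - past_poly n c x).
    by rewrite addrA subrK.
  exact: cabs2D_le.
rewrite -lee_fin; apply: le_trans (Delta_past_poly_ge n c) _; apply: le_trans step _.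
apply: le_trans (_ : ((1 + t) * dl)%:E + ((1 + t^-1) * e)%:E <= _)%E.
  rewrite DE -EFinM leeD2l // EFinM lee_wpmul2l ?lee_fin ?(ltW t1) //.
  exact: ltW.
rewrite -EFinD lee_fin /e [_ * (eta / 2 / _)]mulrC divfK ?gt_eqF //.
have tdl : t * dl <= eta / 2.
  rewrite /t mulrAC ler_pdivrMr // mulrA divfK // ler_wpM2l ?(ltW eta0) //; lra.
by rewrite mulrDl mul1r -addrA lerD2l; lra.
Qed.

End Maximal.
End Extrapolation.

(** * Second-order variables and moving averages *)

Section SecondOrder.
Context {R : realType} d {T : measurableType d} (P : probability T R).
Implicit Types X Y : T -> R[i].

Lemma second_order_integrable X : second_order P X ->
  P.-integrable setT (EFin \o (fun w => cabs (X w) ^+ 2)).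
Proof.
move=> [mX fX]; apply/integrableP; split.
  exact/measurable_EFinP/measurable_cabs2.
apply: le_lt_trans fX; rewrite le_eqVlt; apply/orP; left; apply/eqP.
by apply: eq_integral => w _; rewrite /= ger0_norm // sqr_ge0.
Qed.

Lemma second_order_le X (g : T -> R) : cmeasurable setT X ->
  P.-integrable setT (EFin \o g) -> (forall w, cabs (X w) ^+ 2 <= g w) ->
  second_order P X.
Proof.
move=> mX ig Xg; split=> //; have /integrableP[mg fg] := ig.
apply: le_lt_trans fg; apply: ge0_le_integral => //.
- by move=> w _; rewrite lee_fin sqr_ge0.
- exact/measurable_EFinP/measurable_cabs2.
- exact: measurableT_comp.
- by move=> w _; rewrite /= lee_fin; apply: le_trans (Xg w) (ler_norm _).
Qed.

Lemma cmeasurable_cst (c : R[i]) : cmeasurable setT (fun _ : T => c).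
Proof. by split; exact: measurable_cst. Qed.

Lemma second_order_cst (c : R[i]) : second_order P (fun=> c).
Proof.
apply: (@second_order_le _ (fun=> cabs c ^+ 2)) => //.
exact: finite_measure_integrable_cst.
Qed.

Lemma second_orderZ (c : R[i]) X : second_order P X ->
  second_order P (fun w => c * X w).
Proof.
move=> sX; apply: (@second_order_le _ (fun w => cabs c ^+ 2 * cabs (X w) ^+ 2)).
- by apply: cmeasurable_mul; [exact: cmeasurable_cst|case: sX].
- have := integrableZl measurableT (cabs c ^+ 2) (second_order_integrable sX).
  by apply: eq_integrable => // w _; rewrite /= EFinM.
- by move=> w; rewrite ComplexField.Normc.normcM exprMn.
Qed.

Lemma cmeasurable_add X Y : cmeasurable setT X -> cmeasurable setT Y ->
  cmeasurable setT (fun w => X w + Y w).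
Proof.
move=> mX mY; have mN := cmeasurable_mul (cmeasurable_cst (-1)) mY.
have := cmeasurable_sub mX mN; congr cmeasurable.
by apply/funext => w; rewrite mulN1r opprK.
Qed.

Lemma second_orderD X Y : second_order P X -> second_order P Y ->
  second_order P (fun w => X w + Y w).
Proof.
move=> sX sY.
apply: (@second_order_le _ (fun w => 2 * cabs (X w) ^+ 2 + 2 * cabs (Y w) ^+ 2)).
- by apply: cmeasurable_add; [case: sX|case: sY].
- have iX := integrableZl measurableT 2 (second_order_integrable sX).
  have iY := integrableZl measurableT 2 (second_order_integrable sY).
  by apply: eq_integrable (integrableD measurableT iX iY).
- move=> w; have := cabs2D_le (X w) (Y w) (@ltr01 R).
  by rewrite invr1.
Qed.

Lemma second_order_sum n (X : 'I_n -> T -> R[i]) : (forall i, second_order P (X i)) ->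
  second_order P (fun w => \sum_(i < n) X i w).
Proof.
move=> sX; elim: n X sX => [|n IH] X sX.
  by under eq_fun do rewrite big_ord0; exact: second_order_cst.
under eq_fun do rewrite big_ord_recr /=.
by apply: second_orderD; [exact: IH|exact: sX].
Qed.

Lemma second_orderJ X : second_order P X -> second_order P (fun w => (X w)^*).
Proof.
move=> sX; apply: (@second_order_le _ (fun w => cabs (X w) ^+ 2)).
- case: sX => -[X1 X2] _; split.
    by move: X1; congr measurable_fun; apply/funext => w; case: (X w).
  have := measurable_funN X2; congr measurable_fun.
  by apply/funext => w /=; case: (X w).
- exact: second_order_integrable.
- by move=> w; rewrite cabsJ.
Qed.

Lemma second_order_cintegrableM X Y : second_order P X -> second_order P Y ->
  cintegrable P setT (fun w => X w * Y w).
Proof.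
move=> sX sY; have [mX _] := sX; have [mY _] := sY.
have [m1 m2] := cmeasurable_mul mX mY.
have iXY := integrableD measurableT (second_order_integrable sX) (second_order_integrable sY).
have reim (z : R[i]) : `|complex.Re z| <= cabs z /\ `|complex.Im z| <= cabs z.
  split; rewrite -(@ler_pXn2r _ 2) ?nnegrE ?cabs_ge0 // real_normK ?num_real // cabs2E.
    by rewrite lerDl sqr_ge0.
  by rewrite lerDr sqr_ge0.
have bnd w : cabs (X w * Y w) <= cabs (X w) ^+ 2 + cabs (Y w) ^+ 2.
  rewrite ComplexField.Normc.normcM.
  have := sqr_ge0 (cabs (X w) - cabs (Y w)); have := mulr_ge0 (cabs_ge0 (X w)) (cabs_ge0 (Y w)).
  by nra.
have bnd' w : `|(cabs (X w) ^+ 2 + cabs (Y w) ^+ 2 : R)| = cabs (X w) ^+ 2 + cabs (Y w) ^+ 2.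
  by rewrite ger0_norm // addr_ge0 ?sqr_ge0.
split; apply: le_integrable iXY => //; try exact/measurable_EFinP.
  by move=> w _; rewrite /= lee_fin bnd'; apply: le_trans (bnd w); case: (reim (X w * Y w)).
by move=> w _; rewrite /= lee_fin bnd'; apply: le_trans (bnd w); case: (reim (X w * Y w)).
Qed.

Lemma second_order_cintegrable X : second_order P X -> cintegrable P setT X.
Proof.
move=> sX; have := second_order_cintegrableM sX (second_order_cst 1).
by congr cintegrable; apply/funext => w; rewrite mulr1.
Qed.

Lemma moving_average_density N (c : 'cV[R[i]]_N.+1) (eps : int -> T -> R[i]) :
  white_noise P eps -> has_spectral_density P (moving_average c eps) (ma_density c).
Proof.
move=> [so mean0 cov].
have so1 m j : second_order P (fun w => c m 0 * eps (j - (nat_of_ord m)%:Z) w).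
  exact: second_orderZ.
split; first exact: spectral_density_ma.
- by move=> j; exact: second_order_sum.
- move=> j; rewrite /cexpectation cintegral_sum //; last first.
    by move=> m; exact: second_order_cintegrable.
  rewrite big1 // => m _; rewrite cintegralZ //.
    by rewrite [cintegral _ _ _]mean0 mulr0.
  exact: second_order_cintegrable.
move=> j k; rewrite circle_cmean_expi_cabs2 /cexpectation.
have prodE w : moving_average c eps (j + k) w * (moving_average c eps j w)^* =
    \sum_(m < N.+1) \sum_(l < N.+1) c m 0 * (c l 0)^* *
      (eps (j + k - m%:Z) w * (eps (j - l%:Z) w)^*).
  rewrite /moving_average rmorph_sum mulr_suml; apply: eq_bigr => m _.
  by rewrite mulr_sumr; apply: eq_bigr => l _; rewrite rmorphM /=; ring.
have iprod (m l : nat) : cintegrable P setT (fun w => eps (j + k - m%:Z) w * (eps (j - l%:Z) w)^*).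
  by apply: second_order_cintegrableM => //; exact: second_orderJ.
under eq_cintegral do rewrite prodE.
rewrite cintegral_sum // => [|m].
  apply: eq_bigr => m _; rewrite cintegral_sum // => [|l].
    apply: eq_bigr => l _; rewrite cintegralZ //.
    rewrite [cintegral _ _ _]cov; congr (_ * (nat_of_bool _)%:R).
    (* Times j + k - m and j - l coincide exactly when k - m + l = 0, the frequency condition of the
       Fourier side. *)
    by rewrite -[LHS]subr_eq0; congr (_ == 0); ring.
  exact: cintegrableZ.
apply: cintegrable_sum => // l; exact: cintegrableZ.
Qed.

End SecondOrder.

(** * The saddle point and its consequences *)

Theorem theorem14 (R : realType) (N : nat) (a : 'cV[R[i]]_N.+1) (P0 : R)
    (P0_gt0 : 0 < P0) (d0 : 'cV[R[i]]_N.+1) (nu : R)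
    (d0_candidate : candidate a P0 d0)
    (d0_max : forall d : 'cV[R[i]]_N.+1, candidate a P0 d ->
       sqnorm (opA a d) <= sqnorm (opA a d0))
    (nuE : sqnorm (opA a d0) = nu ^+ 2 * P0) :
  [/\ sqnorm (opAt a d0) = nu ^+ 2 * P0,
      forall (disp : measure_display) (T : measurableType disp)
             (P : probability T R) (eps : int -> T -> R[i]),
        white_noise P eps ->
        has_spectral_density P (moving_average d0 eps) (ma_density d0),
      least_favourable a (D0 P0) (ma_density d0)
    & optimal_char a (ma_density d0) (h_char a d0) /\
      minimax_char a (D0 P0) (h_char a d0)].
Proof.
have [d01 _] := d0_candidate.
have dn : d0 != 0 by rewrite -sqnorm_gt0 d01.
have md := candidates_maximal P0_gt0 d01 d0_max nuE.
pose f0 := ma_density d0; pose m := nu ^+ 2 * P0.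
have sf0 : spectral_density f0 := spectral_density_ma d0.
have mf0 : circle_mean f0 = P0%:E by rewrite ma_density_mean d01.
have Df0 : D0 P0 f0 by split=> //; rewrite mf0.
have D_f0 : Delta a (h_char a d0) f0 = m%:E.
  by rewrite (Delta_h_char dn md sf0) mf0.
have D_le f : D0 P0 f -> (Delta a (h_char a d0) f <= m%:E)%E.
  move=> [sf fP]; rewrite (Delta_h_char dn md sf) /m [leRHS]EFinM.
  by apply: lee_wpmul2l => //; rewrite lee_fin sqr_ge0.
have D_ge g : L2minus f0 g -> (m%:E <= Delta a g f0)%E.
  by move=> /(Delta_ge md); rewrite d01.
have h_L2 f : spectral_density f -> L2minus f (h_char a d0).
  exact: L2minus_h_char dn md _.
have opt : optimal_char a f0 (h_char a d0).
  by split=> [|g /D_ge]; [exact: h_L2|rewrite D_f0].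
have max_h : max_error a (D0 P0) (h_char a d0) = m%:E.
  apply/eqP; rewrite eq_le; apply/andP; split.
    by apply: ge_ereal_sup => _ [f Df <-]; exact: D_le.
  by apply: ereal_sup_ubound; exists f0.
split.
- by rewrite sqnorm_opAt.
- move=> disp T P eps; exact: moving_average_density.
- split=> //; exists (h_char a d0) => //; rewrite D_f0.
  apply/eqP; rewrite eq_le; apply/andP; split.
    apply: le_trans (ereal_sup_ubound _); last by exists f0.
    by apply: le_ereal_inf_tmp => _ [g Lg <-]; exact: D_ge.
  (* For each f in the class, [h_char] is admissible, so the least error is at most its error, hence
     at most m. *)
  apply: ge_ereal_sup => _ [f Df <-].
  apply: le_trans (D_le f Df); apply: ereal_inf_lbound.
  by exists (h_char a d0) => //; apply: h_L2; case: Df.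
- split=> //; split.
  + by move=> f [sf _]; exact: h_L2.
  + by exists f0; rewrite // max_h.
  rewrite max_h; apply/eqP; rewrite eq_le; apply/andP; split.
    apply: ereal_inf_lbound; exists (h_char a d0) => //.
    by move=> f [sf _]; exact: h_L2.
  (* A characteristic admissible for the whole class is admissible for [f0], where its error is
     already at least m. *)
  apply: le_ereal_inf_tmp => _ [g Hg <-].
  apply: le_trans (ereal_sup_ubound _); last by exists f0.
  exact/D_ge/Hg.
Qed.
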